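(* Let $A$ be a Banach algebra with a right identity $e$. If $eA$ is commutative and semisimple, then the following statements hold. (i) The range of every Jordan derivation of $A$ is contained in $\operatorname{rad}(A)$. (ii) If $d_1$ and $d_2$ are two Jordan derivations on $A$, then $d_1 d_2$ is a derivation. (iii) For every positive integer $k$, the zero map is the only $k$-centralizing Jordan derivation of $A$.
   Context: Banach algebras are over $\mathbb{C}$ and associative, and are not assumed to be commutative or unital. A right identity of $A$ is an element $e \in A$ with $ae = a$ for all $a \in A$; then $eA = \{ea : a \in A\}$ is a closed subalgebra of $A$. $\operatorname{rad}(A)$ denotes the (Jacobson) radical of $A$; an algebra is semisimple if its radical is $\{0\}$. A linear map $d: A \to A$ (not assumed continuous) is a derivation if $d(ax) = d(a)x + a\,d(x)$ for all $a, x \in A$, and a Jordan derivation if $d(a^2) = d(a)a + a\,d(a)$ for all $a \in A$. The product $d_1 d_2$ is the composition $a \mapsto d_1(d_2(a))$. For a positive integer $k$, a linear map $T: A \to A$ is $k$-centralizing if $T(a)a^k - a^k T(a) \in Z(A)$ for all $a \in A$, where $Z(A)$ is the center of $A$. *)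

(* Defs.v *)
From HB Require Import structures.
From mathcomp Require Import all_boot all_order all_algebra.
From mathcomp Require Import complex.
From mathcomp Require Import all_classical all_reals all_analysis.

Set Implicit Arguments.
Unset Strict Implicit.
Unset Printing Implicit Defensive.

Import Order.TTheory GRing.Theory Num.Theory.
Import numFieldNormedType.Exports.

Local Open Scope classical_set_scope.
Local Open Scope ring_scope.

Reserved Notation "a ** b" (at level 40, left associativity).

(* MathComp rings are unital, so the product of a Banach algebra that need not
   have a unit is added directly to a complete normed space over R[i] (the
   complex numbers, R being a type of real numbers).  The norm takes its values
   in R[i], where x <= y means that y - x is a nonnegative real. *)
HB.mixin Record CompleteNormedModule_isBanachAlgebra (R : realType) A
    of CompleteNormedModule R[i] A := {
  bmul : A -> A -> A;
  bmulA : associative bmul;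
  bmulDl : left_distributive bmul +%R;
  bmulDr : right_distributive bmul +%R;
  bmulZl : forall (c : R[i]) (a b : A), bmul (c *: a) b = c *: bmul a b;
  bmulZr : forall (c : R[i]) (a b : A), bmul a (c *: b) = c *: bmul a b;
  ler_norm_bmul : forall a b : A, `|bmul a b| <= `|a| * `|b|
}.

#[short(type="banachAlgType")]
HB.structure Definition BanachAlgebra (R : realType) :=
  {A of CompleteNormedModule_isBanachAlgebra R A & CompleteNormedModule R[i] A}.

Notation "a ** b" := (bmul a b) : ring_scope.

Section BanachAlgebraDefs.
Context {R : realType} {A : banachAlgType R}.
Implicit Types (a b e u x : A) (B I J M : set A) (d T : A -> A).

(* a ^ k for k > 0; there is no zeroth power without a unit, and the value at
   k = 0 is junk *)
Definition bexp a (k : nat) : A := iter k.-1 (bmul a) a.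

Definition right_identity e := forall a, a ** e = a.

Definition left_multiples e : set A := range (bmul e).

Definition center : set A := [set z | forall a, z ** a = a ** z].

Definition commutative_on B := forall a b, B a -> B b -> a ** b = b ** a.

(* The radical is defined for any subalgebra B of A, as that of B regarded as
   an algebra in its own right: ideals, modular units and maximality are all
   relative to B.  The radical of A itself is [radical setT]. *)
Definition left_ideal B I :=
  [/\ I `<=` B, I 0,
      forall x y, I x -> I y -> I (x + y),
      forall (c : R[i]) x, I x -> I (c *: x) &
      forall b x, B b -> I x -> I (b ** x)].

Definition modular B I := exists2 u, B u & forall b, B b -> I (b - b ** u).

Definition maximal_modular_left_ideal B M :=
  [/\ left_ideal B M, M <> B, modular B M &
      forall J, left_ideal B J -> M `<=` J -> J <> B -> J = M].

(* The Jacobson radical of a not necessarily unital algebra: the intersection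
   of its maximal modular left ideals, which is B if there are none *)
Definition radical B : set A :=
  [set a | B a /\ forall M, maximal_modular_left_ideal B M -> M a].

Definition semisimple B := radical B = [set 0].

Definition derivation d :=
  linear d /\ forall a x, d (a ** x) = d a ** x + a ** d x.

Definition jordan_derivation d :=
  linear d /\ forall a, d (a ** a) = d a ** a + a ** d a.

Definition centralizing (k : nat) T :=
  linear T /\ forall a, center (T a ** bexp a k - bexp a k ** T a).

End BanachAlgebraDefs.

(* Main.v *)
Require Import Defs.
From HB Require Import structures.
From mathcomp Require Import all_boot all_order all_algebra.
From mathcomp Require Import complex.
From mathcomp Require Import all_classical all_reals all_analysis.
From mathcomp Require Import ring lra.

(* Put N = {n | e n = 0}.  Since a n = (a e) n = a (e n), we have A N = 0, so N
   lies in the radical, and A is the direct sum of eA and N.  If d is a Jordan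
   derivation, then x |-> e d(x) is a derivation of the commutative unital
   semisimple Banach algebra eA, hence zero by Johnson's theorem; it follows that
   d(A) lies in N and that d(xy) = d(x) y, from which all three claims are read off.

   Johnson's theorem: let D be a derivation, S its separating ideal.  If S had a
   nonzero element, a gliding hump (with multipliers killed by suitable characters)
   would make D take a value of infinite norm.  So S = 0, and D is bounded by
   the closed graph theorem.  If phi is a character and phi(a) = 0, then
   phi(D^n(a^n)) = n! phi(D a)^n, while the left side is O(C^n); so
   phi(D a) = 0. *)

Set Implicit Arguments.
Unset Strict Implicit.
Unset Printing Implicit Defensive.

Import Order.TTheory GRing.Theory Num.Theory.
Import numFieldNormedType.Exports.
Import ComplexField.

Local Open Scope classical_set_scope.
Local Open Scope ring_scope.

Local Notation normc := Normc.normc.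

(** * Moduli of complex numbers and algebra seminorms *)

Section ComplexModulus.
Variable R : realType.
Implicit Types (z w : R[i]) (r : R).

(** Semisimplicity of eA enters only through the fact that its characters separate points, so
    maximal ideals must first be turned into characters. The Gelfand-Mazur theorem behind this is
    proved without vector-valued complex analysis: a Lipschitz bound for resolvents averaged over
    roots of unity of order 2^k replaces Liouville's theorem, and only complex square roots and the
    compactness of a square are used. No quotient algebra is formed: B/M is B with a seminorm whose
    null elements are those of M. Derivations need not be continuous, so the growth of D^n(a^n) can
    be compared with n! only once the separating ideal is known to vanish. *)

Lemma normc_norm z : `|z| = (normc z)%:C%C.
Proof. by rewrite normc_def; case: z. Qed.

Lemma normc_real r : normc r%:C%C = `|r|.
Proof. by rewrite /normc /= expr0n /= addr0 sqrtr_sqr. Qed.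

Lemma normc_ge0 z : 0 <= normc z.
Proof. by rewrite -ler0c -normc_norm normr_ge0. Qed.

Lemma normc_gt0 z : z != 0 -> 0 < normc z.
Proof.
by move=> z0; rewrite lt_def normc_ge0 andbT; apply: contra z0 => /eqP/Normc.eq0_normc ->.
Qed.

Lemma normcX z n : normc (z ^+ n) = normc z ^+ n.
Proof. by elim: n => [|n IH]; rewrite ?expr0 ?Normc.normc1 // !exprS Normc.normcM IH. Qed.

Lemma normcD z w : normc (z + w) <= normc z + normc w.
Proof. exact: le_normcD. Qed.

Lemma normc_opp z : normc (- z) = normc z.
Proof. exact: normcN. Qed.

Lemma normc_le_ReIm z : normc z <= `|complex.Re z| + `|complex.Im z|.
Proof.
case: z => a b /=; rewrite /normc.
rewrite -[leRHS]ger0_norm ?addr_ge0 // -sqrtr_sqr ler_sqrt ?sqr_ge0 //.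
rewrite sqrrD !real_normK ?num_real // addrAC lerDl.
by rewrite mulrn_wge0 // mulr_ge0.
Qed.

Lemma Re_le_normc z : `|complex.Re z| <= normc z.
Proof. by rewrite -lecR -normc_norm normc_ge_Re. Qed.

Lemma Im_le_normc z : `|complex.Im z| <= normc z.
Proof.
have -> : normc z = normc (z * 'i%C).
  rewrite Normc.normcM [normc 'i%C]/normc /= expr0n expr1n add0r sqrtr1.
  by rewrite mulr1.
by rewrite -normrN -ReiNIm Re_le_normc.
Qed.

(** Iterated square roots of -1. Multiplying a parameter by such a root flips the sign of its power
    of order 2^k and keeps its modulus, as the averaging of resolvents requires. *)
Lemma exists_root_opp1 (k : nat) :
  exists2 z : R[i], z ^+ (2 ^ k) = -1 & normc z = 1.
Proof.
have [z zk] : exists z : R[i], z ^+ (2 ^ k) = -1.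
  elim: k => [|k [z zk]]; first by exists (-1); rewrite expr1.
  by exists (sqrtc z); rewrite expnS exprM sqr_sqrtc.
exists z => //; apply/eqP; rewrite -(@pexpr_eq1 _ _ (2 ^ k)) ?expn_gt0 //.
  by rewrite -normcX zk normc_opp Normc.normc1.
exact: normc_ge0.
Qed.

Lemma expr_eventually_small (t C e : R) : 0 <= t < 1 -> 0 < e ->
  exists K : nat, forall k, (K <= k)%N -> t ^+ k * C <= e.
Proof.
move=> /andP[t0 t1] e0.
have : (fun k => t ^+ k * C) @ \oo --> (0 * C : R).
  by apply: cvgM; [apply: cvg_expr; rewrite ger0_norm|exact: cvg_cst].
rewrite mul0r => /cvgr0Pnorm_le /(_ _ e0) [K _ HK]; exists K => k Kk.
exact: le_trans (ler_norm _) (HK _ Kk).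
Qed.

Lemma locally_bounded_disk (g : R[i] -> R) :
  (forall z, exists2 d, 0 < d & exists C, forall w, normc (w - z) < d -> g w <= C) ->
  forall r, exists C, forall w, normc w <= r -> g w <= C.
Proof.
move=> gloc r.
have cK := compact_setX (@segment_compact R (- r) r) (@segment_compact R (- r) r).
(* The square covers the disk; compactness, with the bound [C] tending to infinity as parameter,
   merges the local bounds into one. *)
have /compact_near_coveringP/(_ R (pinfty_nbhs R)
  (fun C p => g (p.1 +i* p.2)%C <= C)) nearK := cK.
have {nearK} : \forall C \near +oo, (`[- r, r] `*` `[- r, r]) `<=`
    (fun p => g (p.1 +i* p.2)%C <= C).
  apply: nearK => -[a b] _ /=; have [d d0 [C gC]] := gloc (a +i* b)%C.
  have d20 : 0 < d / 2 by rewrite divr_gt0.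
  exists (ball (a, b) (d / 2), [set t | C <= t]).
    split; first exact: nbhsx_ballx.
    exact: nbhs_pinfty_ge (num_real _).
  move=> [[a' b'] t] /= [[/= aa' bb'] Ct]; apply: le_trans Ct; apply: gC.
  apply: le_lt_trans (normc_le_ReIm _) _ => /=.
  rewrite -ball_normE /= in aa'; rewrite -ball_normE /= in bb'.
  by rewrite [d]splitr ltrD // distrC.
case=> C0 [_ HC]; exists (C0 + 1) => w wr.
have := HC (C0 + 1); rewrite ltrDl => /(_ ltr01 (complex.Re w, complex.Im w)) /=.
case: w wr => a b /= wr; apply.
have /= := le_trans (Re_le_normc (a +i* b)%C) wr.
have /= := le_trans (Im_le_normc (a +i* b)%C) wr.
by rewrite !ler_norml => bb aa; split => /=; rewrite in_itv.
Qed.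

End ComplexModulus.

Section Seminorms.
Variables (R : realType) (B : comAlgType R[i]).

(** A seminorm lets the quotient by an ideal live on [B] itself: equality modulo the ideal reads
    [q (x - y) = 0]. Nonnegativity follows from the axioms, and [q 1] may exceed 1. *)
Record algebra_seminorm (q : B -> R) : Prop := AlgebraSeminorm {
  seminormD : forall x y, q (x + y) <= q x + q y;
  seminormM : forall x y, q (x * y) <= q x * q y;
  seminormZ : forall c x, q (c *: x) = normc c * q x }.

Section Theory.
Variables (q : B -> R) (qP : algebra_seminorm q).

Lemma seminorm0 : q 0 = 0.
Proof. by rewrite -(scale0r 0) (seminormZ qP) Normc.normc0 mul0r. Qed.

Lemma seminormN x : q (- x) = q x.
Proof. by rewrite -scaleN1r (seminormZ qP) normc_opp Normc.normc1 mul1r. Qed.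

Lemma seminorm_sub x y : q (x - y) <= q x + q y.
Proof. by rewrite -[q y]seminormN (seminormD qP). Qed.

Lemma seminorm_distC x y : q (x - y) = q (y - x).
Proof. by rewrite -opprB seminormN. Qed.

Lemma seminorm_ge0 x : 0 <= q x.
Proof.
have := seminorm_sub x x; rewrite subrr seminorm0 -mulr2n -mulr_natl.
by rewrite pmulr_rge0.
Qed.

Lemma seminorm_triangle y x z : q (x - z) <= q (x - y) + q (y - z).
Proof. by rewrite -[x - z](subrKA y) (seminormD qP). Qed.

Lemma seminormX x n : q (x ^+ n.+1) <= q x ^+ n.+1.
Proof.
elim: n => [|n IH]; first by rewrite !expr1.
rewrite exprS [leRHS]exprS (le_trans (seminormM qP _ _)) //.
by rewrite ler_wpM2l ?seminorm_ge0.
Qed.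

Lemma seminorm_le_add x y : q x <= q y + q (x - y).
Proof. by rewrite -[in leLHS](subrKC y x) (seminormD qP). Qed.

Lemma seminorm1_ge1 : q 1 != 0 -> 1 <= q 1.
Proof.
move=> q1; have q1p : 0 < q 1 by rewrite lt_def q1 seminorm_ge0.
by have := seminormM qP 1 1; rewrite mulr1 -[leLHS]mulr1 ler_pM2l.
Qed.

Lemma null_eq x y : q (x - y) = 0 -> q x = q y.
Proof.
move=> xy; apply/eqP; rewrite eq_le.
have := seminorm_le_add x y; rewrite xy addr0 => ->.
by have := seminorm_le_add y x; rewrite seminorm_distC xy addr0 => ->.
Qed.

Lemma null_le x : q x <= 0 -> q x = 0.
Proof. by move=> x0; apply/eqP; rewrite eq_le x0 seminorm_ge0. Qed.

Lemma nullD x y : q x = 0 -> q y = 0 -> q (x + y) = 0.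
Proof. by move=> x0 y0; apply: null_le; rewrite (le_trans (seminormD qP _ _)) // x0 y0 addr0. Qed.

Lemma nullN x : q x = 0 -> q (- x) = 0.
Proof. by rewrite seminormN. Qed.

Lemma nullMl x y : q y = 0 -> q (x * y) = 0.
Proof. by move=> y0; apply: null_le; rewrite (le_trans (seminormM qP _ _)) // y0 mulr0. Qed.

Lemma nullZ c y : q y = 0 -> q (c *: y) = 0.
Proof. by move=> y0; rewrite (seminormZ qP) y0 mulr0. Qed.

End Theory.
End Seminorms.

(** * The Gelfand-Mazur theorem *)

Section GelfandMazur.
Variables (R : realType) (B : comAlgType R[i]) (q : B -> R).
Hypotheses (qP : algebra_seminorm q) (q1 : q 1 != 0).
Variable x : B.

(** * Resolvents modulo null elements *)

Section Resolvent.
Variable f : R[i] -> B.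
Hypothesis fP : forall z, q (f z * (1 - z%:A * x) - 1) = 0.

Lemma resolvent_eq z w : q (f w - f z - (w - z)%:A * (f z * f w * x)) = 0.
Proof.
have -> : f w - f z - (w - z)%:A * (f z * f w * x) =
    f z * (f w * (1 - w%:A * x) - 1) - f w * (f z * (1 - z%:A * x) - 1).
  by rewrite scalerBl; ring.
by apply: (nullD qP); rewrite ?(seminormN qP); apply: (nullMl qP).
Qed.

Lemma resolvent_dist z w : q (f w - f z) <= normc (w - z) * (q (f z) * q (f w) * q x).
Proof.
rewrite (null_eq qP (resolvent_eq z w)) mulr_algl (seminormZ qP).
rewrite ler_wpM2l ?normc_ge0 // (le_trans (seminormM qP _ _)) //.
by rewrite ler_wpM2r ?(seminorm_ge0 qP) // (seminormM qP).
Qed.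

Lemma resolvent_bounded r : exists C, forall w, normc w <= r -> q (f w) <= C.
Proof.
apply: locally_bounded_disk => z.
have k0 : 0 <= q (f z) * q x by rewrite mulr_ge0 ?(seminorm_ge0 qP).
(* Within this radius [resolvent_dist] bounds the difference by half of [q (f w)], which is absorbed
   on the left. *)
exists (1 / (2 * (q (f z) * q x + 1))).
  by rewrite divr_gt0 // mulr_gt0 // ltr_wpDl.
exists (2 * q (f z)) => w; rewrite ltr_pdivlMr; last first.
  by rewrite mulr_gt0 // ltr_wpDl.
move=> wz.
have h1 := resolvent_dist z w; have h2 := seminorm_le_add qP (f w) (f z).
have := seminorm_ge0 qP (f w); have := normc_ge0 (w - z).
move: (normc _) (q (f w)) (q (f w - f z)) wz h1 h2 => n c d wz h1 h2 n0 c0.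
have nk : n * (q (f z) * q x) <= 1 / 2 by nra.
have : n * (q (f z) * c * q x) <= c / 2.
  have -> : n * (q (f z) * c * q x) = c * (n * (q (f z) * q x)) by ring.
  by rewrite [leRHS](_ : _ = c * (1 / 2)) ?ler_wpM2l //; field.
lra.
Qed.

(** The point is that [L] does not depend on [k]: [g z] is the mean of [f] over the products of [z]
    with the roots of unity of order 2^k, and a mean keeps the Lipschitz constant. *)
Lemma resolvent_pow_dist r : 0 <= r -> exists2 L, 0 <= L & forall k,
  exists g : R[i] -> B,
    (forall z, q (g z * (1 - (z%:A * x) ^+ (2 ^ k)) - 1) = 0) /\
    (forall z s, normc z <= r -> 0 <= s <= 1 ->
      q (g z - g (s%:C%C * z)) <= L * (1 - s)).
Proof.
move=> r0; have [C fC] := resolvent_bounded r.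
have C0 : 0 <= C.
  by apply: le_trans (fC 0 _); rewrite ?(seminorm_ge0 qP) // Normc.normc0.
exists (r * (C * C * q x)).
  by rewrite !mulr_ge0 // (seminorm_ge0 qP).
elim=> [|k [g [gP gL]]].
  exists f; split => [z|z s zr /andP[s0 s1]]; first by rewrite expr1.
  have szr : normc (s%:C%C * z) <= r.
    rewrite Normc.normcM normc_real ger0_norm // (le_trans _ zr) //.
    by rewrite ler_piMl ?normc_ge0.
  apply: le_trans (resolvent_dist _ _) _.
  have -> : z - s%:C%C * z = (1 - s)%:C%C * z.
    by rewrite rmorphB rmorph1; ring.
  rewrite Normc.normcM normc_real ger0_norm ?subr_ge0 //.
  rewrite [leRHS](_ : _ = (1 - s) * r * (C * C * q x)); last by ring.
  apply: ler_pM; rewrite ?mulr_ge0 ?normc_ge0 ?(seminorm_ge0 qP) ?subr_ge0 //.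
    by rewrite ler_wpM2l // subr_ge0.
  rewrite ler_wpM2r ?(seminorm_ge0 qP) //.
  by apply: ler_pM; rewrite ?(seminorm_ge0 qP) ?fC.
(* Averaging over a square root of unity turns the inverse of 1 - t into that
   of 1 - t^2; the rotation by the root preserves the Lipschitz bound. *)
have [u uk u1] := exists_root_opp1 R k.
exists (fun z => 2^-1 *: (g z + g (u * z))); split => [z|z s zr s01].
  have -> : 2^-1 *: (g z + g (u * z)) * (1 - (z%:A * x) ^+ (2 ^ k.+1)) - 1 =
    2^-1 *: ((1 + (z%:A * x) ^+ (2 ^ k)) * (g z * (1 - (z%:A * x) ^+ (2 ^ k)) - 1)
     + (1 - (z%:A * x) ^+ (2 ^ k)) *
        (g (u * z) * (1 - ((u * z)%:A * x) ^+ (2 ^ k)) - 1)).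
    have -> : ((u * z)%:A * x) ^+ (2 ^ k) = - (z%:A * x) ^+ (2 ^ k).
      by rewrite -scalerA -scalerAl exprZn uk scaleN1r.
    rewrite expnS mulnC exprM; move: (_ ^+ (2 ^ k)) => t.
    have h : 1 = 2^-1 *: (2 : B).
      by rewrite -[in RHS](scaler_nat 2 (1 : B)) scalerA mulVf ?scale1r // pnatr_eq0.
    rewrite [in X in _ - X = _]h -scalerAl -scalerBr; congr (_ *: _); ring.
  by apply: (nullZ qP); apply: (nullD qP); apply: (nullMl qP).
rewrite -scalerBr (seminormZ qP).
have -> : normc (2^-1 : R[i]) = 2^-1.
  by rewrite -(rmorph_nat (real_complex R)) -fmorphV normc_real ger0_norm.
have -> : u * (s%:C%C * z) = s%:C%C * (u * z) by ring.
have h1 := gL _ _ zr s01.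
have h2 : q (g (u * z) - g (s%:C%C * (u * z))) <= r * (C * C * q x) * (1 - s).
  by apply: gL => //; rewrite Normc.normcM u1 mul1r.
have -> : g z + g (u * z) - (g (s%:C%C * z) + g (s%:C%C * (u * z))) =
   (g z - g (s%:C%C * z)) + (g (u * z) - g (s%:C%C * (u * z))) by ring.
rewrite ler_pdivrMl //; apply: le_trans (seminormD qP _ _) _.
by rewrite mulr_natl mulr2n lerD.
Qed.

End Resolvent.

(** Up to the endpoint, [r] is below the reciprocal of the spectral radius of [x]. Exponents are
    powers of 2 because averaged resolvents are built only for these. *)
Definition power_bounded (r : R) := exists C : R, exists K : nat,
  forall k, (K <= k)%N -> r ^+ (2 ^ k) * q (x ^+ (2 ^ k)) <= C.

Lemma seminorm_scale_pow (r : R) k : 0 <= r ->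
  q ((r%:C%C%:A * x) ^+ (2 ^ k)) = r ^+ (2 ^ k) * q (x ^+ (2 ^ k)).
Proof.
move=> r0; rewrite mulr_algl exprZn (seminormZ qP) normcX normc_real.
by rewrite ger0_norm.
Qed.

(** At a slightly smaller radius the powers are tiny, so the averaged inverse is near 1; the
    Lipschitz bound carries this to radius [s], and an inverse near 1 bounds [1 - y], hence the
    power [y]. One [t] serves all [s <= r], so the step can be iterated. *)
Lemma power_bounded_step (f : R[i] -> B) r :
  (forall z, q (f z * (1 - z%:A * x) - 1) = 0) -> 0 <= r ->
  exists2 t, 0 < t < 1 & forall s, 0 <= s <= r ->
    power_bounded (t * s) -> power_bounded s.
Proof.
move=> fP r0; have [L L0 HL] := resolvent_pow_dist fP r0.
have q1_ge1 := seminorm1_ge1 qP q1; have q1_gt0 := lt_le_trans ltr01 q1_ge1.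
(* Chosen so that [L * (1 - t * t) <= 2 * L * d <= 1 / 4]. *)
pose d : R := (8 * (L + 1))^-1.
have L1 : 0 < L + 1 by rewrite ltr_wpDl.
have d0 : 0 < d by rewrite invr_gt0 mulr_gt0.
have Ld : L * d <= 1 / 8.
  by rewrite ler_pdivrMr ?mulr_gt0 // mulrCA mulrA; lra.
have d1 : d <= 1 / 8.
  rewrite -[d]mulr1 ler_pdivrMl ?mulr_gt0 //; lra.
pose t := 1 - d.
have t01 : 0 <= t < 1 by apply/andP; rewrite /t; split; lra.
exists t => [|s /andP[s0 sr] [C [K HC]]]; first by apply/andP; rewrite /t; split; lra.
have eta0 : 0 < (8 * q 1)^-1 by rewrite invr_gt0 mulr_gt0.
have C0 : 0 <= C.
  apply: le_trans (HC K (leqnn _)).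
  rewrite mulr_ge0 ?(seminorm_ge0 qP) // exprn_ge0 // mulr_ge0 //.
  by case/andP: t01.
have [K' HK'] := expr_eventually_small C t01 eta0.
exists (3 * q 1), (maxn K K') => k; rewrite geq_max => /andP[Kk K'k].
have [g [gP gL]] := HL k.
have t0 : 0 <= t by case/andP: t01.
(* Of the two factors [t] in [w], one reaches the radius where the powers are bounded; the other
   contributes [t ^+ (2 ^ k)] and makes them small. *)
set z : R[i] := s%:C%C; set w : R[i] := (t * (t * s))%:C%C.
have small : q ((w%:A * x) ^+ (2 ^ k)) <= (8 * q 1)^-1.
  rewrite seminorm_scale_pow ?mulr_ge0 // exprMn -mulrA.
  apply: le_trans (ler_wpM2l _ (HC k Kk)) _; first by rewrite exprn_ge0.
  apply: le_trans (HK' (2 ^ k)%N _) => //.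
  by rewrite (leq_trans K'k) // ltnW // ltn_expl.
have gzw : q (g z - g w) <= 1 / 4.
  have -> : w = (t * t)%:C%C * z by rewrite /w mulrA rmorphM.
  apply: le_trans (gL _ _ _ _) _; first by rewrite normc_real ger0_norm.
    by rewrite mulr_ge0 //= mulr_ile1 //; rewrite /t; lra.
  apply: le_trans (ler_wpM2l L0 (_ : _ <= 2 * d)) _; last lra.
  by rewrite /t; have := sqr_ge0 d; rewrite expr2; lra.
rewrite -seminorm_scale_pow // -/z.
move: small (gP w) (gP z); move: (_ ^+ (2 ^ k)) (_ ^+ (2 ^ k)) (g z) (g w) gzw.
move=> y y' a b ab y's bP aP.
have b1 : q (b - 1) <= q b * q y'.
  apply: le_trans (seminormM qP _ _).
  rewrite le_eqVlt; apply/orP; left; apply/eqP/(null_eq qP).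
  by rewrite -[RHS]bP; congr q; ring.
have qb := seminorm_le_add qP b 1.
have b2 : q b * q y' <= q b * (8 * q 1)^-1.
  by rewrite ler_wpM2l // (seminorm_ge0 qP).
have e8 : (8 * q 1)^-1 <= 1 / 8.
  rewrite -[leLHS]mulr1 ler_pdivrMl ?mulr_gt0 //; lra.
have qb2 : q b <= 2 * q 1.
  have := ler_wpM2l (seminorm_ge0 qP b) e8; lra.
have b3 : q (b - 1) <= 1 / 4.
  apply: le_trans b1 _; apply: le_trans b2 _.
  apply: le_trans (ler_wpM2r _ qb2) _; first by rewrite ltW.
  by rewrite ler_pdivrMr ?mulr_gt0 //; lra.
have a1 : q (a - 1) <= 1 / 2 by have := seminorm_triangle qP b a 1; lra.
(* As [a] inverts [1 - y] up to null elements, [1 - y] equals [1 - (a - 1) * (1 - y)], whose last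
   term is at most half of the left side. *)
have v1 : q (1 - y) <= q 1 + q (a - 1) * q (1 - y).
  have {1}-> : q (1 - y) = q (1 - (a - 1) * (1 - y)).
    by apply: (null_eq qP); rewrite -[RHS]aP; congr q; ring.
  by rewrite (le_trans (seminorm_sub qP _ _)) // lerD2l (seminormM qP).
have v2 : q (1 - y) <= 2 * q 1.
  have := ler_wpM2r (seminorm_ge0 qP (1 - y)) a1; lra.
have := seminorm_le_add qP y 1; rewrite (seminorm_distC qP y); lra.
Qed.

Lemma power_bounded_start : exists2 r, 0 < r & forall s, 0 <= s <= r -> power_bounded s.
Proof.
have x1 : 0 < q x + 1 by rewrite ltr_wpDl // (seminorm_ge0 qP).
exists (q x + 1)^-1 => [|s /andP[s0 sr]]; first by rewrite invr_gt0.
exists 1, 0%N => k _; case e : (2 ^ k)%N => [|n].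
  by have := expn_gt0 2 k; rewrite e.
apply: le_trans (ler_wpM2l _ (seminormX qP _ _)) _; first by rewrite exprn_ge0.
rewrite -exprMn exprn_ile1 ?mulr_ge0 ?(seminorm_ge0 qP) //.
apply: le_trans (ler_wpM2r (seminorm_ge0 qP _) sr) _.
by rewrite ler_pdivrMl // mulr1 lerDl.
Qed.

(** Up to null elements [y ^+ n * x ^+ n = 1], so the extra factor 2 makes the products grow at
    least like [2 ^+ n]. *)
Lemma power_unbounded y : q (y * x - 1) = 0 -> ~ power_bounded (2 * q y).
Proof.
move=> yx [C [K HC]].
have q1_ge1 := seminorm1_ge1 qP q1.
have pow n : q ((y * x) ^+ n - 1) = 0.
  elim: n => [|n IH]; first by rewrite expr0 subrr (seminorm0 qP).
  have -> : (y * x) ^+ n.+1 - 1 = (y * x) * ((y * x) ^+ n - 1) + (y * x - 1).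
    by rewrite exprS; ring.
  by apply: (nullD qP) => //; apply: (nullMl qP).
have ge k : (2 : R) ^+ (2 ^ k) <= (2 * q y) ^+ (2 ^ k) * q (x ^+ (2 ^ k)).
  rewrite exprMn -mulrA ler_peMr ?exprn_ge0 // (le_trans q1_ge1) //.
  rewrite -(null_eq qP (pow (2 ^ k)%N)) exprMn (le_trans (seminormM qP _ _)) //.
  rewrite ler_wpM2r ?(seminorm_ge0 qP) //.
  case e : (2 ^ k)%N => [|n]; first by have := expn_gt0 2 k; rewrite e.
  exact: seminormX.
have half : 0 <= (2^-1 : R) < 1 by apply/andP; split; lra.
have [K' HK'] := expr_eventually_small (C + 1) half (ltr01 : 0 < (1 : R)).
pose k := maxn K K'.
have := HK' (2 ^ k)%N (leq_trans (leq_maxr K K') (ltnW (ltn_expl _ (ltnSn 1)))).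
rewrite exprVn ler_pdivrMl ?exprn_gt0 // mulr1.
by have := le_trans (ge k) (HC k (leq_maxl _ _)); lra.
Qed.

(* The powers r^n x^n (n = 2^k) are bounded for small r, and by the uniform
   Lipschitz bound on the inverses of 1 - r^n x^n the set of such r
   is open on the right with uniform step; so they are bounded
   for all r, which contradicts the invertibility of x. *)
Lemma gelfand_mazur : (forall y, q y != 0 -> exists z, q (z * y - 1) = 0) ->
  exists c, q (x - c%:A) = 0.
Proof.
move=> qinv; apply: contrapT => /forallNP noeig.
have /choice[f fP] z : exists y, q (y * (1 - z%:A * x) - 1) = 0.
  apply: qinv; have [->|z0] := eqVneq z 0.
    by rewrite scale0r mul0r subr0.
  have -> : 1 - z%:A * x = - z *: (x - z^-1%:A).
    rewrite mulr_algl scaleNr scalerBr scalerA mulfV // scale1r; ring.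
  rewrite (seminormZ qP) normc_opp mulf_neq0 //.
    by apply: contra z0 => /eqP/Normc.eq0_normc ->.
  by apply/eqP.
have [y yx] : exists y, q (y * x - 1) = 0.
  by apply: qinv; apply/eqP => x0; apply: (noeig 0); rewrite scale0r subr0.
have r0 : 0 <= 2 * q y by rewrite mulr_ge0 ?(seminorm_ge0 qP).
have [t /andP[t0 t1] step] := power_bounded_step fP r0.
have [s s0 start] := power_bounded_start.
(* The step is read downwards: unboundedness at [2 * q y] descends to radii where
   [power_bounded_start] contradicts it. *)
have nb n : ~ power_bounded (t ^+ n * (2 * q y)).
  elim: n => [|n IH]; first by rewrite expr0 mul1r; exact: power_unbounded.
  rewrite exprS -mulrA => h; apply: IH; apply: step h.
  by rewrite mulr_ge0 ?exprn_ge0 ?(ltW t0) //= ler_piMl // exprn_ile1 // ltW.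
have t01 : 0 <= t < 1 by rewrite (ltW t0) t1.
have [K HK] := expr_eventually_small (2 * q y) t01 s0.
apply: (nb K); apply: start.
by rewrite mulr_ge0 ?exprn_ge0 ?(ltW t0) //= HK.
Qed.

End GelfandMazur.

(** * Characters of Banach algebras *)

Section BanachNorms.
Variables (R : realType) (B : comAlgType R[i]) (nu : B -> R).

(** Completeness is stated for geometrically small steps with an explicit error, the sum of the
    remaining steps, so that [B] needs no topology. *)
Record banach_norm : Prop := BanachNorm {
  banach_seminorm :> algebra_seminorm nu;
  banach_separated : forall x, nu x = 0 -> x = 0;
  banach_complete : forall (u : nat -> B) (C : R),
    (forall n, nu (u n.+1 - u n) <= C / 2 ^+ n) ->
    exists l, forall n, nu (u n - l) <= 2 * C / 2 ^+ n }.

Record character (phi : B -> R[i]) : Prop := Character {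
  characterD : forall x y, phi (x + y) = phi x + phi y;
  characterM : forall x y, phi (x * y) = phi x * phi y;
  characterZ : forall c x, phi (c *: x) = c * phi x;
  character1 : phi 1 = 1;
  character_le : forall x, normc (phi x) <= nu x }.

Hypothesis nuP : banach_norm.

Lemma exists_half_pow_lt (C e : R) : 0 < e -> exists n, C / 2 ^+ n < e.
Proof.
move=> e0; have e20 : 0 < e / 2 by rewrite divr_gt0.
have half : 0 <= (2^-1 : R) < 1 by apply/andP; split; lra.
have [K HK] := expr_eventually_small C half e20.
by exists K; have := HK K (leqnn _); rewrite exprVn mulrC; lra.
Qed.

Lemma banach_eq (C : R) x y : (forall n, nu (x - y) <= C / 2 ^+ n) -> x = y.
Proof.
move=> xy; apply/eqP; rewrite -subr_eq0; apply/eqP/(banach_separated nuP).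
apply: (null_le nuP); apply/ler_addgt0Pr => e e0; rewrite add0r.
by have [n Hn] := exists_half_pow_lt C e0; rewrite (le_trans (xy n)) // ltW.
Qed.

Lemma neumann_inverse h : nu h <= 1 / 2 -> exists w, (1 - h) * w = 1.
Proof.
move=> h2; pose u n := \sum_(k < n) h ^+ k.
have hn n : nu (h ^+ n) <= nu 1 / 2 ^+ n.
  elim: n => [|n IH]; first by rewrite !expr0 divr1.
  rewrite exprSr (le_trans (seminormM nuP _ _)) //.
  rewrite exprSr invfM mulrA ler_pM ?(seminorm_ge0 nuP) //; lra.
have [n|w Hw] := banach_complete nuP (u := u) (C := nu 1).
  by rewrite /u big_ord_recr /= addrAC subrr add0r.
exists w; apply: (@banach_eq (nu (1 - h) * (2 * nu 1) + nu 1)) => n.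
have -> : (1 - h) * w - 1 = - ((1 - h) * (u n - w)) - h ^+ n.
  have -> : h ^+ n = (h - 1) * u n + 1 by rewrite /u -subrX1 subrK.
  by ring.
apply: le_trans (seminorm_sub nuP _ _) _.
rewrite (seminormN nuP) [leRHS]mulrDl lerD // (le_trans (seminormM nuP _ _)) //.
by rewrite -mulrA ler_wpM2l ?(seminorm_ge0 nuP).
Qed.

(** * The quotient seminorm of an ideal *)

Section Quotient.
Variable M : set B.
Hypotheses (M0 : M 0) (MD : forall x y, M x -> M y -> M (x + y)).
Hypotheses (MM : forall a x, M x -> M (a * x)) (M1 : ~ M 1).

Definition quotient_seminorm (x : B) : R := inf [set nu (x - m) | m in M].

Lemma quotient_seminorm_le x m : M m -> quotient_seminorm x <= nu (x - m).
Proof.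
move=> Mm; apply: ge_inf; last by exists m.
by exists 0 => _ [m' _ <-]; exact: (seminorm_ge0 nuP).
Qed.

Lemma quotient_seminorm_lt x e : quotient_seminorm x < e ->
  exists2 m, M m & nu (x - m) < e.
Proof.
move=> /inf_lt -[|_ [m Mm <-] me]; first by exists (nu (x - 0)), 0.
by exists m.
Qed.

Lemma quotient_seminorm_ge0 x : 0 <= quotient_seminorm x.
Proof.
apply: lb_le_inf; first by exists (nu (x - 0)), 0.
by move=> _ [m' _ <-]; exact: (seminorm_ge0 nuP).
Qed.

Lemma ideal_scale c x : M x -> M (c *: x).
Proof. by rewrite -mulr_algl; exact: MM. Qed.

Lemma quotient_seminormP : algebra_seminorm quotient_seminorm.
Proof.
split => [x y|x y|c x].
- apply/ler_addgt0Pr => e e0; have e20 : 0 < e / 2 by rewrite divr_gt0.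
  have [m Mm xm] : exists2 m, M m & nu (x - m) < quotient_seminorm x + e / 2.
    by apply: quotient_seminorm_lt; rewrite ltrDl.
  have [n Mn yn] : exists2 m, M m & nu (y - m) < quotient_seminorm y + e / 2.
    by apply: quotient_seminorm_lt; rewrite ltrDl.
  apply: le_trans (quotient_seminorm_le _ (MD Mm Mn)) _.
  have -> : x + y - (m + n) = (x - m) + (y - n) by ring.
  by have := seminormD nuP (x - m) (y - n); lra.
- apply/ler_addgt0Pr => e e0.
  have a0 := quotient_seminorm_ge0 x; have b0 := quotient_seminorm_ge0 y.
  pose s := quotient_seminorm x + quotient_seminorm y + 1.
  have s1 : 1 <= s by rewrite /s; lra.
  have s0 : 0 < s by lra.
  (* With [a], [b] the two quotient values and [d <= 1], one has [(a + d) * (b + d) <= a * b + d * s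
     <= a * b + e]. *)
  pose d := Num.min 1 (e / s).
  have d0 : 0 < d by rewrite lt_min ltr01 divr_gt0.
  have d1 : d <= 1 by rewrite ge_min lexx.
  have ds : d * s <= e by rewrite -ler_pdivlMr // ge_min lexx orbT.
  have [m Mm xm] : exists2 m, M m & nu (x - m) < quotient_seminorm x + d.
    by apply: quotient_seminorm_lt; rewrite ltrDl.
  have [n Mn yn] : exists2 m, M m & nu (y - m) < quotient_seminorm y + d.
    by apply: quotient_seminorm_lt; rewrite ltrDl.
  have Mmn : M (x * n + (y - n) * m) by apply: MD; apply: MM.
  apply: le_trans (quotient_seminorm_le _ Mmn) _.
  have -> : x * y - (x * n + (y - n) * m) = (x - m) * (y - n) by ring.
  apply: le_trans (seminormM nuP _ _) _.
  apply: le_trans (ler_pM _ _ (ltW xm) (ltW yn)) _; rewrite ?(seminorm_ge0 nuP) //.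
  by move: ds; rewrite /s; nra.
- have half (k : R[i]) z : quotient_seminorm (k *: z) <= normc k * quotient_seminorm z.
    have [->|k0] := eqVneq k 0.
      rewrite scale0r Normc.normc0 mul0r.
      by rewrite (le_trans (quotient_seminorm_le _ M0)) // subr0 (seminorm0 nuP).
    have nk := normc_gt0 k0.
    rewrite -ler_pdivrMl //; apply/ler_addgt0Pr => e e0.
    have [m Mm xm] : exists2 m, M m & nu (z - m) < quotient_seminorm z + e.
      by apply: quotient_seminorm_lt; rewrite ltrDl.
    rewrite ler_pdivrMl //.
    apply: le_trans (quotient_seminorm_le _ (ideal_scale k Mm)) _.
    by rewrite -scalerBr (seminormZ nuP) ler_wpM2l ?normc_ge0 // ltW.
  apply/eqP; rewrite eq_le half /=.
  have [->|c0] := eqVneq c 0.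
    by rewrite Normc.normc0 mul0r quotient_seminorm_ge0.
  have nc := normc_gt0 c0.
  rewrite -ler_pdivlMl // -Normc.normcV; apply: le_trans (half _ _).
  by rewrite scalerA mulVf // scale1r.
Qed.

Lemma quotient_seminorm_null x : M x -> quotient_seminorm x = 0.
Proof.
move=> Mx; apply: (null_le quotient_seminormP).
by rewrite (le_trans (quotient_seminorm_le _ Mx)) // subrr (seminorm0 nuP).
Qed.

(** An element of [M] within 1/2 of 1 would be invertible by the Neumann series. *)
Lemma quotient_seminorm1 : quotient_seminorm 1 != 0.
Proof.
apply/eqP => q1.
have [|m Mm m2] := @quotient_seminorm_lt 1 (1 / 2); first by rewrite q1; lra.
have [w] := neumann_inverse (ltW m2); rewrite subKr mulrC => w1.
by apply: M1; rewrite -w1; apply: MM.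
Qed.

Hypothesis Minv : forall x, ~ M x -> exists y, M (y * x - 1).

(** Maximal ideals are closed: an inverse of a null [x] modulo [M] would make 1 null. *)
Lemma quotient_seminorm_null_in x : quotient_seminorm x = 0 -> M x.
Proof.
move=> qx; apply: contrapT => /Minv[y Myx].
have qP := quotient_seminormP; move/eqP: quotient_seminorm1; apply.
rewrite -(null_eq qP (quotient_seminorm_null Myx)).
exact: (nullMl qP).
Qed.

(** [phi x] is the scalar to which Gelfand-Mazur reduces [x] modulo [M]; its uniqueness, from
    [q 1 != 0], makes [phi] a homomorphism. *)
Lemma maximal_ideal_character :
  exists2 phi, character phi & forall x, phi x = 0 -> M x.
Proof.
have qP := quotient_seminormP; have q1 := quotient_seminorm1.
set q := quotient_seminorm in qP q1.
have q1_ge1 := seminorm1_ge1 qP q1.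
have /choice[phi phiP] x : exists c, q (x - c%:A) = 0.
  apply: (gelfand_mazur qP q1) => y y0.
  have [|z] := @Minv y; last by exists z; exact: quotient_seminorm_null.
  by move=> My; move/eqP: y0; apply; exact: quotient_seminorm_null.
have uniq x c : q (x - c%:A) = 0 -> phi x = c.
  move=> xc; apply/eqP; rewrite -subr_eq0; apply/eqP/Normc.eq0_normc.
  have : q ((phi x - c)%:A) = 0.
    have -> : (phi x - c)%:A = (x - c%:A) - (x - (phi x)%:A).
      by rewrite scalerBl; ring.
    by apply: (nullD qP) => //; apply: (nullN qP).
  rewrite (seminormZ qP) => /eqP; rewrite mulf_eq0 => /orP[/eqP //|].
  by rewrite (negbTE q1).
exists phi.
  split.
  - move=> x y; apply: uniq.
    have -> : x + y - (phi x + phi y)%:A = (x - (phi x)%:A) + (y - (phi y)%:A).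
      by rewrite scalerDl; ring.
    exact: (nullD qP).
  - move=> x y; apply: uniq.
    have -> : x * y - (phi x * phi y)%:A =
        y * (x - (phi x)%:A) + (phi x)%:A * (y - (phi y)%:A).
      by rewrite -scalerA -(mulr_algl (phi x)); ring.
    by apply: (nullD qP); apply: (nullMl qP).
  - move=> c x; apply: uniq.
    by rewrite -scalerA -scalerBr; apply: (nullZ qP).
  - by apply: uniq; rewrite scale1r subrr (seminorm0 qP).
  - move=> x; apply: (@le_trans _ _ (q x)).
      rewrite (null_eq qP (phiP x)) (seminormZ qP) ler_peMr //; exact: normc_ge0.
    by have := quotient_seminorm_le x M0; rewrite subr0.
move=> x x0; apply: quotient_seminorm_null_in.
by have := phiP x; rewrite x0 scale0r subr0.
Qed.

End Quotient.
End BanachNorms.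

(** * Bounded derivations *)

Section CharacterTheory.
Variables (R : realType) (B : comAlgType R[i]) (nu : B -> R).
Variables (phi : B -> R[i]) (phiP : character nu phi).

Lemma character0 : phi 0 = 0.
Proof. by rewrite -(scale0r 0) (characterZ phiP) mul0r. Qed.

Lemma characterN x : phi (- x) = - phi x.
Proof. by rewrite -scaleN1r (characterZ phiP) mulN1r. Qed.

Lemma characterB x y : phi (x - y) = phi x - phi y.
Proof. by rewrite (characterD phiP) characterN. Qed.

Lemma characterMn x n : phi (x *+ n) = phi x *+ n.
Proof. by elim: n => [|n IH]; rewrite ?mulr0n ?character0 // !mulrS (characterD phiP) IH. Qed.

End CharacterTheory.

Section Derivations.
Variables (R : realType) (B : comAlgType R[i]) (nu : B -> R).
Hypothesis nuP : banach_norm nu.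
Variable D : B -> B.
Hypotheses (DD : forall x y, D (x + y) = D x + D y).
Hypotheses (DZ : forall c x, D (c *: x) = c *: D x).
Hypotheses (DM : forall x y, D (x * y) = D x * y + x * D y).

Lemma der0 : D 0 = 0.
Proof. by rewrite -(scale0r 0) DZ !scale0r. Qed.

Lemma derN x : D (- x) = - D x.
Proof. by rewrite -scaleN1r DZ scaleN1r. Qed.

Lemma derB x y : D (x - y) = D x - D y.
Proof. by rewrite DD derN. Qed.

Lemma derMn x n : D (x *+ n) = D x *+ n.
Proof. by elim: n => [|n IH]; rewrite ?mulr0n ?der0 // !mulrS DD IH. Qed.

Lemma derX x n : D (x ^+ n.+1) = x ^+ n * D x *+ n.+1.
Proof.
elim: n => [|n IH]; first by rewrite expr0 mul1r expr1.
by rewrite exprS DM IH [D x * _]mulrC -mulrnAr mulrA -exprS mulrnAr -mulrS.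
Qed.

Lemma der_iterD n x y : iter n D (x + y) = iter n D x + iter n D y.
Proof. by elim: n => //= n ->; rewrite DD. Qed.

Lemma der_iterMn n x k : iter n D (x *+ k) = iter n D x *+ k.
Proof. by elim: n => //= n ->; rewrite derMn. Qed.

Section AtCharacter.
Variables (phi : B -> R[i]) (phiP : character nu phi) (a : B).
Hypothesis phia : phi a = 0.

(** Each [D] removes at most one factor [a], and any remaining one is killed by [phi]. The cofactor
    [y] collects the [D a] already split off, as the induction requires. *)
Lemma character_der_iter k : forall n y, (k <= n)%N ->
  phi (iter k D (a ^+ n * y)) =
    if k == n then n`!%:R * phi (D a) ^+ n * phi y else 0.
Proof.
elim: k => [|k IH] [|n] y // kn.
- by rewrite /= expr0 mul1r fact0 expr0 !mul1r.
- by rewrite /= exprS -mulrA (characterM phiP) phia mul0r.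
rewrite iterSr DM derX der_iterD (characterD phiP).
have -> : a ^+ n * D a *+ n.+1 * y = (a ^+ n * (D a * y)) *+ n.+1.
  by rewrite mulrnAl mulrA.
rewrite der_iterMn (characterMn phiP) !IH // ?(ltnW kn) // eqSS.
rewrite [k == n.+1]ltn_eqF // addr0; case: eqP => [_|_]; last by rewrite mul0rn.
by rewrite (characterM phiP) factS natrM exprS -mulr_natl; ring.
Qed.

Lemma bounded_der_character_eq0 C : (forall x, nu (D x) <= C * nu x) -> phi (D a) = 0.
Proof.
move=> DC; apply: contrapT => Da0.
have s0 : 0 < normc (phi (D a)) by apply: normc_gt0; apply/eqP.
set s := normc _ in s0.
have C0 : 0 <= C.
  rewrite leNgt; apply/negP => C0.
  have : 0 <= C * nu (D a) by rewrite (le_trans _ (DC _)) // (seminorm_ge0 nuP).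
  by rewrite nmulr_rge0 // leNgt (lt_le_trans s0 (character_le phiP _)).
have iterC n x : nu (iter n D x) <= C ^+ n * nu x.
  elim: n => [|n IH]; first by rewrite expr0 mul1r.
  by rewrite exprS -mulrA (le_trans (DC _)) // ler_wpM2l.
pose Y := C * nu a / s.
have Y0 : 0 <= Y by rewrite !mulr_ge0 ?(seminorm_ge0 nuP) // invr_ge0 ltW.
have facY n : n.+1`!%:R <= Y ^+ n.+1.
  have := character_le phiP (iter n.+1 D (a ^+ n.+1 * 1)).
  rewrite character_der_iter // eqxx (character1 phiP) !mulr1.
  rewrite Normc.normcM normcX -/s.
  rewrite -(rmorph_nat (real_complex R)) normc_real ger0_norm //.
  rewrite -ler_pdivlMr ?exprn_gt0 // => h; apply: le_trans h _.
  rewrite /Y expr_div_n ler_pM2r ?invr_gt0 ?exprn_gt0 // exprMn.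
  apply: le_trans (iterC _ _) _.
  by rewrite ler_wpM2l ?exprn_ge0 // (seminormX nuP).
(* If [n! <= Y ^+ n] for all positive [n], then [(2 * Y) ^+ n / n!] is at least [2 ^+ n], yet it
   never exceeds [E]. *)
pose E := expR (2 * Y).
have half : 0 <= (2^-1 : R) < 1 by apply/andP; split; lra.
have [K HK] := expr_eventually_small (E + 1) half (ltr01 : 0 < (1 : R)).
have := HK K.+1 (leqnSn _); rewrite exprVn ler_pdivrMl ?exprn_gt0 // mulr1.
have : (2 : R) ^+ K.+1 <= E.
  have Y20 : 0 <= 2 * Y by rewrite mulr_ge0.
  apply: le_trans (expR_ge1Dxn K Y20).
  apply: (@le_trans _ _ ((2 * Y) ^+ K.+1 / K.+1`!%:R)); last by rewrite lerDr.
  rewrite exprMn -mulrA ler_peMr ?exprn_ge0 // ler_pdivlMr ?ltr0n ?fact_gt0 //.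
  by rewrite mul1r facY.
lra.
Qed.

End AtCharacter.
End Derivations.

(** * The closed graph theorem *)

Lemma indexed_dependent_choice (T : Type) (P : nat -> T -> Prop)
    (Q : nat -> T -> T -> Prop) (t0 : T) :
  P 0%N t0 -> (forall n t, P n t -> exists2 t', P n.+1 t' & Q n t t') ->
  exists u : nat -> T, u 0%N = t0 /\ forall n, P n (u n) /\ Q n (u n) (u n.+1).
Proof.
move=> Pt0 step.
have /choice[f fP] (p : nat * T) : exists t', P p.1 p.2 -> P p.1.+1 t' /\ Q p.1 p.2 t'.
  have [/step[t' Pt' Qt']|nP] := pselect (P p.1 p.2); first by exists t'.
  by exists t0.
pose u := fix u n := if n is m.+1 then f (m, u m) else t0.
exists u; split => // n.
have Pu : P n (u n) by elim: n => //= n /(fP (n, u n))[].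
by have [] := fP (n, u n) Pu.
Qed.

Section ClosedGraph.
Variables (R : realType) (B : comAlgType R[i]) (nu : B -> R).
Hypothesis nuP : banach_norm nu.

Lemma seminorm_real_scale (r : R) x : 0 <= r -> nu (r%:C%C *: x) = r * nu x.
Proof. by move=> r0; rewrite (seminormZ nuP) normc_real ger0_norm. Qed.

Variable T : B -> B.
Hypotheses (TD : forall x y, T (x + y) = T x + T y).
Hypotheses (TZ : forall c x, T (c *: x) = c *: T x).

Let TN x : T (- x) = - T x.
Proof. by rewrite -scaleN1r TZ scaleN1r. Qed.

Let TB x y : T (x - y) = T x - T y.
Proof. by rewrite TD TN. Qed.

Let T0 : T 0 = 0.
Proof. by have := TZ 0 0; rewrite !scale0r. Qed.

(** The limits of [T x_n] along sequences [x_n] tending to 0; they measure how far the graph of [T]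
    is from being closed. *)
Definition separating : set B :=
  [set s | forall e, 0 < e -> exists2 x, nu x < e & nu (T x - s) < e].

(** This is what Baire's theorem yields for the covering of [B] by the sets where
    [nu (T y) <= k]. *)
Definition almost_bounded (k r : R) := forall x, nu x < r ->
  forall e, 0 < e -> exists2 y, nu (y - x) < e & nu (T y) <= k.

Lemma almost_bounded_scale c k r : 0 < c ->
  almost_bounded k r -> almost_bounded (c * k) (c * r).
Proof.
move=> c0 H x xr e e0; have cn : c != 0 by rewrite gt_eqF.
have ci0 : 0 <= c^-1 by rewrite invr_ge0 ltW.
have [||y yx Ty] := H (c^-1%:C%C *: x) _ (c^-1 * e).
- by rewrite seminorm_real_scale // ltr_pdivrMl.
- by rewrite mulr_gt0 ?invr_gt0.
exists (c%:C%C *: y); last first.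
  by rewrite TZ seminorm_real_scale ?ler_wpM2l // ltW.
have -> : c%:C%C *: y - x = c%:C%C *: (y - c^-1%:C%C *: x).
  by rewrite scalerBr scalerA -rmorphM mulfV // rmorph1 scale1r.
by rewrite seminorm_real_scale ?(ltW c0) // -ltr_pdivlMl.
Qed.

(** Unboundedness near the origin moves to any [s]: if [T] took small values near both [s + x] and
    [s - x], half the difference of two such points would be near [x] with a small value. *)
Lemma exists_ball_unbounded (k d : R) s : (forall r, 0 < r -> ~ almost_bounded k r) ->
  0 < d -> exists2 p : B * R, 0 < p.2 <= d / 2 /\ nu (p.1 - s) <= d / 2 &
    forall y, nu (y - p.1) <= p.2 -> k < nu (T y).
Proof.
move=> nb d0; have d20 : 0 < d / 2 by rewrite divr_gt0.
have /existsNP[x /not_implyP[xd /existsNP[e /not_implyP[e0 xe]]]] := nb _ d20.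
have {}xe y : nu (y - x) < e -> k < nu (T y).
  by move=> yx; rewrite ltNge; apply/negP => Ty; apply: xe; exists y.
have [s' s's Hs'] : exists2 s', nu (s' - s) <= d / 2 &
    forall y, nu (y - s') < e -> k < nu (T y).
  have [H|] := pselect (forall y, nu (y - (s + x)) < e -> k < nu (T y)).
    by exists (s + x) => //; rewrite addrAC subrr add0r ltW.
  move=> /existsNP[y1 /not_implyP[y1e /negP]]; rewrite -leNgt => Ty1.
  exists (s - x); first by rewrite addrAC subrr add0r (seminormN nuP) ltW.
  move=> y2 y2e; rewrite ltNge; apply/negP => Ty2.
  have h0 : 0 <= (2^-1 : R) by rewrite invr_ge0.
  have := xe (2^-1%:C%C *: (y1 - y2)); rewrite TZ TB seminorm_real_scale //.
  have -> : 2^-1%:C%C *: (y1 - y2) - x =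
      2^-1%:C%C *: ((y1 - (s + x)) - (y2 - (s - x))) :> B.
    have -> : y1 - (s + x) - (y2 - (s - x)) = y1 - y2 - 2%:R *: x.
      by rewrite scaler_nat mulr2n; ring.
    rewrite [in RHS]scalerBr scalerA -(rmorph_nat (real_complex R)) -rmorphM.
    by rewrite mulVf // rmorph1 scale1r.
  rewrite seminorm_real_scale //.
  have := seminorm_sub nuP (y1 - (s + x)) (y2 - (s - x)).
  have := seminorm_sub nuP (T y1) (T y2).
  move=> h1 h2 h3; have : k < 2^-1 * nu (T y1 - T y2) by apply: h3; lra.
  by lra.
have e20 : 0 < e / 2 by rewrite divr_gt0.
exists (s', Num.min (d / 2) (e / 2)) => /=.
  by rewrite lt_min d20 e20 ge_min lexx.
by move=> y ys; apply: Hs'; apply: le_lt_trans ys _; rewrite gt_min; apply/orP; right; lra.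
Qed.

(* Baire's theorem, as a nested sequence of balls on the n-th of which T is
   larger than n *)
Lemma exists_almost_bounded : exists2 r, 0 < r & almost_bounded 1 r.
Proof.
apply: contrapT => nex.
have nb (k : nat) r : 0 < r -> ~ almost_bounded k%:R r.
  move=> r0 H; apply: nex.
  have k0 : 0 < (k%:R + 1 : R)^-1 by rewrite invr_gt0 ltr_wpDl.
  exists ((k%:R + 1)^-1 * r); first by rewrite mulr_gt0.
  move=> x xr e e0.
  have [y yx Ty] := almost_bounded_scale k0 H xr e0; exists y => //.
  by rewrite (le_trans Ty) // ler_pdivrMl ?mulr1 ?lerDl // ltr_wpDl.
pose P (n : nat) (p : B * R) := 0 < p.2 <= 1 / 2 ^+ n.
pose Q (n : nat) (p p' : B * R) := [/\ p'.2 <= p.2 / 2, nu (p'.1 - p.1) <= p.2 / 2 &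
  forall y, nu (y - p'.1) <= p'.2 -> n%:R < nu (T y)].
have [||u [u0 uP]] := @indexed_dependent_choice _ P Q (0, 1).
- by rewrite /P /= expr0 ltr01 divr1 lexx.
- move=> n [s d] /andP[/= d0 dn].
  have [p' [/andP[p0 pd] ps] Hp] := exists_ball_unbounded s (nb n) d0.
  exists p'; last by split.
  by rewrite /P p0 (le_trans pd) // exprSr invfM mulrA ler_wpM2r.
have [n|l Hl] := banach_complete nuP (u := fun n => (u n).1) (C := 1).
  have [/andP[_ Pn] [_ Qn _]] := uP n; apply: le_trans Qn _.
  by have [/andP[p0 _] _] := uP n; lra.
(* A centre moves by at most the radius lost, so the distances telescope and the limit stays in
   every ball. *)
have near m n : nu ((u (n + m)%N).1 - (u n).1) <= (u n).2 - (u (n + m)%N).2.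
  elim: m => [|m IH]; first by rewrite addn0 !subrr (seminorm0 nuP).
  have [_ [h1 h2 _]] := uP (n + m)%N; rewrite addnS.
  by have := seminorm_triangle nuP (u (n + m)%N).1 (u (n + m).+1).1 (u n).1; lra.
have lin n : nu (l - (u n).1) <= (u n).2.
  apply/ler_addgt0Pr => e e0; have [m Hm] := exists_half_pow_lt (2 * 1) e0.
  have mnm : (2 : R) * 1 / 2 ^+ (n + m) <= 2 * 1 / 2 ^+ m.
    rewrite ler_wpM2l // lef_pV2 ?posrE ?exprn_gt0 // ler_eXn2l ?leq_addl //.
    by rewrite ltr1n.
  have h1 := Hl (n + m)%N; rewrite (seminorm_distC nuP _ l) in h1.
  have h2 := near m n; have [/andP[p0 _] _] := uP (n + m)%N.
  have := seminorm_triangle nuP (u (n + m)%N).1 l (u n).1; lra.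
have big n : n%:R < nu (T l) by have [_ [_ _]] := uP n; apply.
have := big (Num.trunc (nu (T l))).+1; rewrite ltNge; apply/negPn.
by rewrite negbK ltW // truncnS_gt.
Qed.

Lemma closed_graph : separating `<=` [set 0] ->
  exists C, forall x, nu (T x) <= C * nu x.
Proof.
move=> sep0; have [r r0 ab] := exists_almost_bounded.
(* Successive approximation: each remainder [u n] is reduced by a nearby [y] with
   [nu (T y) <= 1 / 2 ^+ n]. Remainders tend to 0, so if [T x - T (u n)] tends to [l], then
   [T x - l] lies in the separating space; hence [T x = l]. *)
have T2 x : nu x < r -> nu (T x) <= 2.
  move=> xr.
  pose P (n : nat) z := nu z < (2 ^+ n)^-1 * r.
  pose Q (n : nat) z z' := nu (T z' - T z) <= 1 / 2 ^+ n.
  have [||u [u0 uP]] := @indexed_dependent_choice _ P Q x.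
  - by rewrite /P expr0 invr1 mul1r.
  - move=> n z zn.
    have n0 : 0 < (2 ^+ n : R)^-1 by rewrite invr_gt0 exprn_gt0.
    have e0 : 0 < (2 ^+ n.+1)^-1 * r by rewrite mulr_gt0 ?invr_gt0 ?exprn_gt0.
    have [y yz Ty] := almost_bounded_scale n0 ab zn e0.
    exists (z - y); first by rewrite /P (seminorm_distC nuP).
    rewrite /Q -TB addrAC subrr add0r TN (seminormN nuP) (le_trans Ty) //.
    by rewrite mulrC.
  have [n|l Hl] := banach_complete nuP (u := fun n => T x - T (u n)) (C := 1).
    have [_ Qn] := uP n.
    rewrite [X in nu X](_ : _ = T (u n) - T (u n.+1)); last by ring.
    by rewrite (seminorm_distC nuP).
  have : separating (T x - l).
    move=> e e0; have [m Hm] := exists_half_pow_lt (2 + r) e0.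
    have i0 : 0 < (2 ^+ m : R)^-1 by rewrite invr_gt0 exprn_gt0.
    rewrite mulrDl in Hm.
    have h2 : 0 < 2 / 2 ^+ m :> R by rewrite mulr_gt0.
    have h3 : 0 < r / 2 ^+ m by rewrite mulr_gt0.
    exists (u m); first by have [Pm _] := uP m; rewrite /P mulrC in Pm; lra.
    have := Hl m; rewrite mulr1 => Hlm.
    have -> : T (u m) - (T x - l) = - (T x - T (u m) - l) by ring.
    by rewrite (seminormN nuP); lra.
  move=> /sep0 /= /eqP; rewrite subr_eq0 => /eqP ->.
  have := Hl 0%N; rewrite u0 subrr sub0r (seminormN nuP) expr0 divr1; lra.
(* [x] is rescaled to norm [r / 2], where [T] is at most 2. *)
exists (4 / r) => x; have [x0|x0] := eqVneq (nu x) 0.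
  by rewrite (banach_separated nuP x0) T0 (seminorm0 nuP) mulr0.
have nx : 0 < nu x by rewrite lt_def x0 (seminorm_ge0 nuP).
have c0 : 0 < r / (2 * nu x) by rewrite divr_gt0 // mulr_gt0.
have := T2 ((r / (2 * nu x))%:C%C *: x).
rewrite TZ !seminorm_real_scale ?(ltW c0) //.
have -> : r / (2 * nu x) * nu x = r / 2 by field.
move=> H; have {}H : r / (2 * nu x) * nu (T x) <= 2 by apply: H; lra.
rewrite -(ler_pM2l c0) (le_trans H) //.
have -> : r / (2 * nu x) * (4 / r * nu x) = 2 by field; rewrite x0 gt_eqF.
by [].
Qed.

End ClosedGraph.

(** * Johnson's theorem *)

Section Johnson.
Variables (R : realType) (B : comAlgType R[i]) (nu : B -> R).
Hypothesis nuP : banach_norm nu.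

(** [w n] is the sum of [x n], [g n * x n.+1], [g n * g n.+1 * x n.+2] and so on; the recursive form
    factors every tail exactly, as the gliding hump needs. *)
Lemma nested_series (g x : nat -> B) :
  (forall n, nu (g n) <= 1) -> (forall n, nu (x n) <= 1 / 2 ^+ n) ->
  exists w : nat -> B, forall n, w n = x n + g n * w n.+1.
Proof.
move=> g1 x2.
pose v := fix v (k n : nat) : B := if k is l.+1 then x n + g n * v l n.+1 else 0.
have gM n y : nu (g n * y) <= nu y.
  by rewrite (le_trans (seminormM nuP _ _)) // ler_piMl ?(seminorm_ge0 nuP).
have dv k n : nu (v k.+1 n - v k n) <= 1 / 2 ^+ k.
  (* The difference is [x (n + k)] times factors of norm at most 1; this sharper bound survives the
     shift of [n] in the induction. *)
  suff : nu (v k.+1 n - v k n) <= 1 / 2 ^+ (n + k).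
    move=> h; apply: le_trans h _; rewrite ler_wpM2l // lef_pV2 ?posrE ?exprn_gt0 //.
    by rewrite ler_eXn2l ?leq_addl // ltr1n.
  elim: k n => [|k IH] n; first by rewrite /= mulr0 addr0 subr0 addn0.
  rewrite [v k.+2 n]/= [v k.+1 n]/=.
  rewrite opprD addrACA subrr add0r -mulrBr (le_trans (gM _ _)) //.
  by rewrite addnS -addSn; exact: IH.
have /choice[w wP] n : exists l, forall k, nu (v k n - l) <= 2 * 1 / 2 ^+ k.
  by apply: (banach_complete nuP) => k; exact: dv.
exists w => n; apply: (@banach_eq _ _ _ nuP (2 * 1 + 2 * 1)) => k.
have -> : w n - (x n + g n * w n.+1) =
    g n * (v k n.+1 - w n.+1) - (v k.+1 n - w n) by rewrite /=; ring.
apply: le_trans (seminorm_sub nuP _ _) _; rewrite [leRHS]mulrDl lerD //.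
  exact: le_trans (gM _ _) (wP _ _).
apply: le_trans (wP _ _) _; rewrite ler_wpM2l ?mulr_ge0 //.
by rewrite lef_pV2 ?posrE ?exprn_gt0 // ler_eXn2l ?ltr1n.
Qed.

Variable D : B -> B.
Hypotheses (DD : forall x y, D (x + y) = D x + D y).
Hypotheses (DZ : forall c x, D (c *: x) = c *: D x).
Hypotheses (DM : forall x y, D (x * y) = D x * y + x * D y).
Hypothesis ss : forall x, (forall phi, character nu phi -> phi x = 0) -> x = 0.

Let S := separating nu D.

Lemma separating_mul b s : S s -> S (b * s).
Proof.
move=> Ss e e0; pose k := nu (D b) + nu b + 1.
have Db0 := seminorm_ge0 nuP (D b); have b0 := seminorm_ge0 nuP b.
have k0 : 0 < k by rewrite /k; lra.
have ek0 : 0 < e / k by rewrite divr_gt0.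
have [x xe Dxs] := Ss _ ek0; exists (b * x).
  apply: le_lt_trans (seminormM nuP _ _) _.
  rewrite ltr_pdivlMr // in xe; have x0 := seminorm_ge0 nuP x.
  by rewrite /k in xe; nra.
have -> : D (b * x) - b * s = D b * x + b * (D x - s) by rewrite DM; ring.
apply: le_lt_trans (seminormD nuP _ _) _.
have h1 := seminormM nuP (D b) x; have h2 := seminormM nuP b (D x - s).
have h3 := ler_wpM2l Db0 (ltW xe); have h4 := ler_wpM2l b0 (ltW Dxs).
have : (nu (D b) + nu b) * (e / k) < e.
  rewrite mulrA ltr_pdivrMr // mulrC ltr_pM2l // /k; lra.
lra.
Qed.

(** A tiny [x] with [D x] near [s] has [phi (D (c * x))] near [phi c * phi s], so a large multiple
    stays small in norm but gets a large value. [p] is the contribution of earlier terms, to be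
    outweighed. *)
Lemma separating_character_unbounded phi s c (p : R[i]) (M d : R) :
  character nu phi -> S s -> phi s != 0 -> phi c != 0 -> 0 < d -> 0 <= M ->
  exists2 x, nu x <= d & M <= normc (p + phi (D (c * x))).
Proof.
move=> phiP Ss phis phic d0 M0.
have a0 := normc_gt0 phic; have b0 := normc_gt0 phis.
have k0 := normc_ge0 (phi (D c)).
set a := normc (phi c) in a0; set b := normc (phi s) in b0.
set k := normc (phi (D c)) in k0.
(* [eta] is half the limiting modulus; [e] keeps the error within the other half, and
   [lam * eta = M + normc p]. *)
pose eta := a * b / 2; have eta0 : 0 < eta by rewrite divr_gt0 ?mulr_gt0.
pose lam := (M + normc p) / eta.
have lam0 : 0 <= lam by rewrite divr_ge0 ?addr_ge0 ?normc_ge0 // ltW.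
have e1 : 0 < eta / (a + k) by rewrite divr_gt0 // ltr_pwDl.
have e2 : 0 < d / (lam + 1) by rewrite divr_gt0 // ltr_wpDl.
pose e := Num.min (eta / (a + k)) (d / (lam + 1)).
have e0 : 0 < e by rewrite lt_min e1 e2.
have eta_e : e * (a + k) <= eta by rewrite -ler_pdivlMr ?ltr_pwDl // ge_min lexx.
have d_e : e * (lam + 1) <= d by rewrite -ler_pdivlMr ?ltr_wpDl // ge_min lexx orbT.
have [x xe Dxs] := Ss e e0.
exists (lam%:C%C *: x).
  by rewrite (seminorm_real_scale nuP) //; have := seminorm_ge0 nuP x; nra.
rewrite -scalerAr DZ (characterZ phiP) DM (characterD phiP) !(characterM phiP).
have h1 : normc (phi x) <= e by rewrite (le_trans (character_le phiP x)) // ltW.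
have h2 : normc (phi s - phi (D x)) <= e.
  by rewrite -(characterB phiP) (le_trans (character_le phiP _)) // (seminorm_distC nuP) ltW.
have h3 : b <= normc (phi (D x)) + e.
  rewrite /b -[phi s](subrKC (phi (D x))) (le_trans (normcD _ _)) //.
  by rewrite lerD2l.
set q := phi (D c) * phi x + phi c * phi (D x).
have h4 : eta <= normc q.
  have : a * normc (phi (D x)) <= normc q + k * normc (phi x).
    rewrite /a /k -!Normc.normcM -[leLHS]normc_opp.
    have -> : - (phi c * phi (D x)) = phi (D c) * phi x - q by rewrite /q; ring.
    by rewrite addrC (le_trans (normcD _ _)) // normc_opp.
  have := ler_wpM2l k0 h1; have := ler_wpM2l (ltW a0) h3.
  rewrite /eta in eta_e *; lra.
have h5 : normc (lam%:C%C * q) <= normc (p + lam%:C%C * q) + normc p.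
  have {1}-> : lam%:C%C * q = (p + lam%:C%C * q) - p by ring.
  by rewrite (le_trans (normcD _ _)) // normc_opp.
rewrite Normc.normcM normc_real ger0_norm // in h5.
have := ler_wpM2l lam0 h4.
have -> : lam * eta = M + normc p by rewrite /lam divfK // gt_eqF.
lra.
Qed.

(* If only one character phi were nonzero at c, then c / phi c would be an
   idempotent killed by D, spanning an ideal on which D vanishes. *)
Lemma exists_two_characters c : S c -> c != 0 ->
  exists phi psi b, [/\ character nu phi, character nu psi &
    [/\ phi c != 0, psi c != 0, phi b = 0, psi b != 0 & nu b <= 1]].
Proof.
move=> Sc c0.
have [phi phiP phic] : exists2 phi, character nu phi & phi c != 0.
  apply: contrapT => none; move/eqP: c0; apply; apply: ss => phi phiP.
  by apply: contrapT => /eqP phic; apply: none; exists phi.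
have [[psi [b [psiP psic phib psib]]]|none] := pselect (exists psi b,
    [/\ character nu psi, psi c != 0, phi b = 0 & psi b != 0]).
  have n0 : 0 <= (nu b + 1)^-1 by rewrite invr_ge0 addr_ge0 ?(seminorm_ge0 nuP).
  have n1 : 0 < nu b + 1 by rewrite ltr_wpDl ?(seminorm_ge0 nuP).
  exists phi, psi, ((nu b + 1)^-1%:C%C *: b); split => //; split => //.
  - by rewrite (characterZ phiP) phib mulr0.
  - rewrite (characterZ psiP) mulf_neq0 // fmorph_eq0 invr_eq0 gt_eqF //.
  - by rewrite (seminorm_real_scale nuP) // ler_pdivrMl // mulr1 lerDl.
have only psi : character nu psi -> psi c != 0 -> forall y, psi y = phi y.
  move=> psiP psic y; apply: contrapT => /eqP ne; apply: none.
  exists psi, (y - (phi y)%:A); split => //.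
    by rewrite (characterB phiP) (characterZ phiP) (character1 phiP) mulr1 subrr.
  by rewrite (characterB psiP) (characterZ psiP) (character1 psiP) mulr1 subr_eq0.
pose p := (phi c)^-1 *: c.
have phip : phi p = 1 by rewrite (characterZ phiP) mulVf.
have pmul y : p * y = phi y *: p.
  apply/eqP; rewrite -subr_eq0; apply/eqP; apply: ss => psi psiP.
  rewrite (characterB psiP) (characterM psiP) !(characterZ psiP).
  have [->|psic] := eqVneq (psi c) 0; first by rewrite !(mulr0, mul0r) subrr.
  by rewrite (only _ psiP psic y); ring.
have phiDp : phi (D p) = 0.
  have : phi (D (p * p)) = phi (D p) by rewrite pmul phip scale1r.
  rewrite DM (characterD phiP) !(characterM phiP) phip mul1r mulr1 => /eqP.
  by rewrite -subr_eq0 addrK => /eqP.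
(* Then no value of [D] comes near [p], where [phi] is 1, although [p] lies in [S]. *)
have phiD y : phi (D y) = 0.
  have := congr1 (phi \o D) (pmul y); rewrite /= DZ (characterZ phiP) phiDp mulr0.
  by rewrite DM (characterD phiP) !(characterM phiP) phip phiDp mul0r add0r mul1r.
have Sp : S p by rewrite /p -mulr_algl; exact: separating_mul.
have half : 0 < 1 / 2 :> R by rewrite divr_gt0.
have [x _ Dxp] := Sp _ half.
have := le_lt_trans (character_le phiP _) Dxp.
by rewrite (characterB phiP) phiD phip sub0r normc_opp Normc.normc1; lra.
Qed.

(* Gliding hump: z = sum_n c_n x_n with c_n = c b_0^2 ... b_(n-1)^2.  Since phi_n
   kills b_n, the character phi_n does not see D of the terms beyond the n-th. *)
Lemma separating_eq0 : S `<=` [set 0].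
Proof.
move=> s Ss /=; apply: contrapT => /eqP s0.
(* A state is [((c, p), (b, x))]: multiplier, partial sum, and the choices that led to them. The
   multiplier takes [b] squared, since [D] can remove only one of two factors and leaves [phi] one
   to kill. *)
pose P (n : nat) (t : (B * B) * (B * B)) := S t.1.1 /\ t.1.1 != 0.
pose Q (n : nat) (t t' : (B * B) * (B * B)) :=
  [/\ t'.1.1 = t.1.1 * (t'.2.1 * t'.2.1), t'.1.2 = t.1.2 + t.1.1 * t'.2.2,
      nu t'.2.1 <= 1, nu t'.2.2 <= 1 / 2 ^+ n &
      exists phi, [/\ character nu phi, phi t'.2.1 = 0 & n%:R <= normc (phi (D t'.1.2))]].
have [||u [u0 uP]] := @indexed_dependent_choice _ P Q ((s, 0), (0, 0)).
- by [].
- move=> n [[c p] y] [/= Sc c0].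
  (* [phi] sees the present hump and is killed by [b]; [psi] witnesses that the next multiplier is
     nonzero. *)
  have [phi [psi [b [phiP psiP [phic psic phib psib b1]]]]] := exists_two_characters Sc c0.
  have d0 : 0 < 1 / 2 ^+ n :> R by rewrite divr_gt0 ?exprn_gt0.
  have [x xd xn] :=
    separating_character_unbounded (phi (D p)) phiP Sc phic phic d0 (ler0n _ n).
  exists ((c * (b * b), p + c * x), (b, x)).
    split => /=; first by rewrite mulrC; exact: separating_mul.
    have : psi (c * (b * b)) != 0 by rewrite !(characterM psiP) !mulf_neq0.
    by apply: contra => /eqP ->; rewrite (character0 psiP).
  split => //=; exists phi; split => //.
  by rewrite DD (characterD phiP).
pose b n := (u n.+1).2.1; pose x n := (u n.+1).2.2.
have [n|n|w wP] := @nested_series (fun n => b n * b n) x.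
- have [_ [_ _ b1 _ _]] := uP n; rewrite (le_trans (seminormM nuP _ _)) //.
  by rewrite mulr_ile1 ?(seminorm_ge0 nuP).
- by have [_ []] := uP n.
pose z := s * w 0%N.
have zE n : (u n).1.1 * w n + (u n).1.2 = z.
  elim: n => [|n <-]; first by rewrite u0 /= addr0.
  have [_ [-> -> _ _ _]] := uP n; rewrite -/(b n) -/(x n) (wP n); ring.
have big n : n%:R <= nu (D z).
  have [_ [cE _ _ _ [phi [phiP phib pn]]]] := uP n.
  suff -> : D z = D (u n.+1).1.2 + (D z - D (u n.+1).1.2).
    rewrite (le_trans pn) // (le_trans _ (character_le phiP _)) //.
    rewrite (characterD phiP) -(derB DD DZ) -(zE n.+1) addrK cE.
    rewrite !DM !(characterM phiP, characterD phiP) phib.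
    by rewrite !(mulr0, mul0r, addr0).
  by rewrite subrKC.
have := big (Num.trunc (nu (D z))).+1; rewrite leNgt; apply/negP.
by rewrite negbK truncnS_gt.
Qed.

Theorem derivation_eq0 x : D x = 0.
Proof.
have [C DC] := closed_graph nuP DD DZ separating_eq0.
apply: ss => phi phiP.
have D1 : D 1 = 0.
  have := DM 1 1; rewrite !mulr1 mul1r => /eqP.
  by rewrite -subr_eq0 opprD addrA subrr sub0r oppr_eq0 => /eqP.
have -> : D x = D (x - (phi x)%:A) by rewrite (derB DD DZ) DZ D1 scaler0 subr0.
apply: (bounded_der_character_eq0 nuP DD DZ DM phiP _ DC).
by rewrite (characterB phiP) (characterZ phiP) (character1 phiP) mulr1 subrr.
Qed.

End Johnson.

(** * The corner eA *)

Section RealNorm.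
Variables (R : realType) (A : banachAlgType R).
Implicit Types a b x y : A.

Definition real_norm (x : A) : R := complex.Re `|x|.

Lemma real_normE x : `|x| = (real_norm x)%:C%C.
Proof. by rewrite RRe_real // ger0_real. Qed.

Lemma real_norm_ge0 x : 0 <= real_norm x.
Proof. by rewrite -ler0c -real_normE. Qed.

Lemma real_normD x y : real_norm (x + y) <= real_norm x + real_norm y.
Proof. by rewrite -lecR rmorphD /= -!real_normE ler_normD. Qed.

Lemma real_normM x y : real_norm (x ** y) <= real_norm x * real_norm y.
Proof. by rewrite -lecR rmorphM /= -!real_normE ler_norm_bmul. Qed.

Lemma real_normZ c x : real_norm (c *: x) = normc c * real_norm x.
Proof.
by apply: (@complexI R); rewrite rmorphM /= -!real_normE normrZ normc_norm.
Qed.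

Lemma real_norm_eq0 x : real_norm x = 0 -> x = 0.
Proof. by move=> x0; apply/eqP; rewrite -normr_eq0 real_normE x0. Qed.

Lemma real_norm_distC x y : real_norm (x - y) = real_norm (y - x).
Proof. by apply: (@complexI R); rewrite -!real_normE distrC. Qed.

Lemma real_norm_triangle y x z :
  real_norm (x - z) <= real_norm (x - y) + real_norm (y - z).
Proof. by rewrite -[x - z](subrKA y) real_normD. Qed.

Lemma real_norm_complete (u : nat -> A) (C : R) :
  (forall n, real_norm (u n.+1 - u n) <= C / 2 ^+ n) ->
  exists l, forall n, real_norm (u n - l) <= 2 * C / 2 ^+ n.
Proof.
move=> uC.
have C0 : 0 <= C.
  by have := le_trans (real_norm_ge0 _) (uC 0%N); rewrite expr0 divr1.
have tail n m : real_norm (u n - u (n + m)%N) <= 2 * C / 2 ^+ n - 2 * C / 2 ^+ (n + m).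
  elim: m => [|m IH].
    by rewrite addn0 !subrr /real_norm normr0.
  have h1 := uC (n + m)%N; rewrite real_norm_distC in h1.
  rewrite addnS; have h2 := real_norm_triangle (u (n + m)%N) (u n) (u (n + m).+1).
  have -> : 2 * C / 2 ^+ (n + m).+1 = C / 2 ^+ (n + m).
    by rewrite exprS; field; rewrite expf_neq0 // pnatr_eq0.
  lra.
have tail2 n m : real_norm (u n - u (n + m)%N) <= 2 * C / 2 ^+ n.
  by apply: le_trans (tail n m) _; rewrite gerBl !mulr_ge0 // invr_ge0 exprn_ge0.
have realpos (eps : R[i]) : 0 < eps -> exists2 r : R, 0 < r & eps = r%:C%C.
  move=> e0; have er : eps = (complex.Re eps)%:C%C by rewrite RRe_real // gtr0_real.
  by exists (complex.Re eps) => //; rewrite -ltcR -er.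
have : cvg (u @ \oo).
  apply/cauchy_cvgP/cauchy_exP => eps /realpos[r r0 ->].
  have [N HN] := exists_half_pow_lt (2 * C) r0.
  exists (u N); exists N => // n /= Nn.
  rewrite -ball_normE /= real_normE ltcR.
  by apply: le_lt_trans HN; rewrite -(subnKC Nn) tail2.
move=> /cvg_ex[l ul]; exists l => n.
apply/ler_addgt0Pr => r r0.
have /cvgrPdist_le /(_ r%:C%C) := ul; rewrite ltcR => /(_ r0)[N _ HN].
have := HN (n + N)%N (leq_addl _ _).
rewrite real_normE lecR (real_norm_distC l) => h.
have := real_norm_triangle (u (n + N)%N) (u n) l; have := tail2 n N; lra.
Qed.

Lemma bmul0 x : x ** 0 = 0.
Proof. by have := bmulZr 0 x 0; rewrite !scale0r. Qed.

Lemma b0mul x : 0 ** x = 0.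
Proof. by have := bmulZl 0 0 x; rewrite !scale0r. Qed.

Lemma bmulN x y : x ** (- y) = - (x ** y).
Proof. by rewrite -scaleN1r bmulZr scaleN1r. Qed.

Lemma bmulBr x y z : x ** (y - z) = x ** y - x ** z.
Proof. by rewrite bmulDr bmulN. Qed.

Lemma bmulBl x y z : (x - y) ** z = x ** z - y ** z.
Proof. by rewrite bmulDl -scaleN1r bmulZl scaleN1r. Qed.

End RealNorm.

Section Corner.
Variables (R : realType) (A : banachAlgType R) (e : A).

(** For a right identity [e], idempotence makes eA the fixed points of left multiplication by [e],
    which gives a boolean predicate. *)
Definition corner_pred : {pred A} := fun x => e ** x == x.

Lemma corner_predE x : (x \in corner_pred) = (e ** x == x).
Proof. by []. Qed.

Lemma corner_submod_closed : submod_closed corner_pred.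
Proof.
split => [|c x y]; rewrite !corner_predE.
  by rewrite bmul0.
by move=> /eqP ex /eqP ey; rewrite bmulDr bmulZr ex ey.
Qed.

HB.instance Definition _ :=
  GRing.isSubmodClosed.Build R[i] A corner_pred corner_submod_closed.

(* The unused arguments let the ring instances below depend on these hypotheses. *)
Definition corner of right_identity e & commutative_on (left_multiples e) &
  e != 0 := {x : A | x \in corner_pred}.

Hypotheses (he : right_identity e) (hc : commutative_on (left_multiples e)).
Hypothesis (e0 : e != 0).
Local Notation eA := (corner he hc e0).

HB.instance Definition _ := SubChoice.on eA.
HB.instance Definition _ := [SubChoice_isSubLmodule of eA by <:].

Lemma corner_fix (x : eA) : e ** val x = val x.
Proof. by apply/eqP; exact: (valP x). Qed.

Lemma corner_mul_subproof (x y : eA) : val x ** val y \in corner_pred.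
Proof. by rewrite corner_predE bmulA corner_fix. Qed.

Lemma corner_one_subproof : e \in corner_pred.
Proof. by rewrite corner_predE he. Qed.

Definition corner_mul (x y : eA) : eA :=
  exist (fun x => x \in corner_pred) _ (corner_mul_subproof x y).
Definition corner_one : eA := exist (fun x => x \in corner_pred) _ corner_one_subproof.

Lemma corner_valM x y : val (corner_mul x y) = val x ** val y.
Proof. by []. Qed.

Lemma corner_mulA : associative corner_mul.
Proof. by move=> x y z; apply: val_inj; rewrite !corner_valM bmulA. Qed.

Lemma corner_mulC : commutative corner_mul.
Proof.
move=> x y; apply: val_inj; rewrite !corner_valM.
by apply: hc; [exists (val x)|exists (val y)]; rewrite ?corner_fix.
Qed.

Lemma corner_mul1 : left_id corner_one corner_mul.
Proof. by move=> x; apply: val_inj; rewrite !corner_valM corner_fix. Qed.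

Lemma corner_mulD : left_distributive corner_mul +%R.
Proof. by move=> x y z; apply: val_inj; rewrite !(corner_valM, raddfD) /= bmulDl. Qed.

Lemma corner_one_neq0 : corner_one != 0.
Proof. by rewrite -(inj_eq val_inj) raddf0. Qed.

HB.instance Definition _ := GRing.Zmodule_isComNzRing.Build eA
  corner_mulA corner_mulC corner_mul1 corner_mulD corner_one_neq0.

Lemma corner_scaleAl (c : R[i]) (x y : eA) : c *: (x * y) = c *: x * y.
Proof. by apply: val_inj; rewrite !(corner_valM, linearZ) /= bmulZl. Qed.

HB.instance Definition _ := GRing.Lmodule_isLalgebra.Build R[i] eA corner_scaleAl.
HB.instance Definition _ := GRing.Lalgebra_isComAlgebra.Build R[i] eA.

Definition corner_norm (x : eA) : R := real_norm (val x).

Lemma corner_banach_norm : banach_norm corner_norm.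
Proof.
split=> [|x|u C uC].
- split=> [x y|x y|c x]; rewrite /corner_norm.
  + by rewrite raddfD real_normD.
  + exact: real_normM.
  + by rewrite linearZ real_normZ.
- by move=> /real_norm_eq0 x0; apply: val_inj; rewrite x0 raddf0.
have [|l Hl] := @real_norm_complete _ _ (fun n => val (u n)) C.
  by move=> n; have := uC n; rewrite /corner_norm raddfB.
have el : l \in corner_pred.
  rewrite corner_predE -subr_eq0; apply/eqP/real_norm_eq0/eqP.
  rewrite eq_le real_norm_ge0 andbT; apply/ler_addgt0Pr => r r0; rewrite add0r.
  have [n Hn] := exists_half_pow_lt ((real_norm e + 1) * (2 * C)) r0.
  apply: le_trans (ltW Hn).
  have -> : e ** l - l = e ** (l - val (u n)) + (val (u n) - l).
    by rewrite bmulBr corner_fix addrA subrK.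
  rewrite (le_trans (real_normD _ _)) // -[leRHS]mulrA mulrDl mul1r lerD ?Hl //.
  rewrite (le_trans (real_normM _ _)) // ler_wpM2l ?real_norm_ge0 //.
  by rewrite real_norm_distC.
exists (exist (fun x => x \in corner_pred) l el) => n.
by rewrite /corner_norm raddfB; exact: Hl.
Qed.

Lemma left_multiplesP x : left_multiples e x <-> e ** x = x.
Proof.
by split=> [[y _ <-]|<-]; [rewrite bmulA he|exists x].
Qed.

(** Every maximal modular ideal of eA contains the kernel of a character, so an element killed by
    all characters lies in the radical. *)
Lemma corner_semisimple : semisimple (left_multiples e) ->
  forall x : eA, (forall phi, character corner_norm phi -> phi x = 0) -> x = 0.
Proof.
move=> ss x xphi; apply: val_inj; rewrite raddf0.
suff : radical (left_multiples e) (val x) by rewrite ss.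
split=> [|M [[MB M0 MD MZ MM] MneB _ Mmax]].
  exact/left_multiplesP/corner_fix.
pose M' : set eA := [set y | M (val y)].
have M'M (a y : eA) : M' y -> M' (a * y).
  by move=> My; apply: MM => //; exact/left_multiplesP/corner_fix.
have [|||y|phi phiP phiM] := @maximal_ideal_character _ _ _ corner_banach_norm M' _ _ M'M.
- exact: M0.
- by move=> y z My Mz; exact: MD.
- move=> Me; apply: MneB; apply/seteqP; split=> // b Bb.
  by rewrite -(he b); apply: MM.
(* By maximality [M] plus the multiples of [y] is all of eA; writing [e] in this form exhibits an
   inverse of [y] modulo [M]. *)
- move=> nMy; pose J : set A := [set a | exists m (b : eA), M m /\ a = m + val b ** val y].
  have JM : M `<=` J by move=> m Mm; exists m, 0; rewrite raddf0 b0mul addr0.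
  have JB : J = left_multiples e.
    apply: contrapT => JneB; apply: nMy; rewrite /M' /= -(Mmax J) //.
      by exists 0, 1; split=> //; rewrite add0r corner_fix.
    split.
    + move=> _ [m [b [Mm ->]]]; apply/left_multiplesP.
      by rewrite bmulDr bmulA corner_fix; congr (_ + _); exact/left_multiplesP/MB.
    + exact: JM.
    + move=> _ _ [m [b [Mm ->]]] [n [c [Mn ->]]]; exists (m + n), (b + c).
      by split; [exact: MD|rewrite raddfD bmulDl addrACA].
    + move=> c _ [m [b [Mm ->]]]; exists (c *: m), (c *: b).
      by split; [exact: MZ|rewrite linearZ bmulZl scalerDr].
    + move=> a _ /left_multiplesP ea [m [b [Mm ->]]].
      have ea' : a \in corner_pred by rewrite corner_predE ea.
      pose a' : eA := exist (fun x => x \in corner_pred) a ea'.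
      exists (a ** m), (a' * b); split; last by rewrite bmulDr bmulA.
      by apply: MM => //; apply/left_multiplesP.
  have : J e by rewrite JB; apply/left_multiplesP; rewrite he.
  move=> [m [b [Mm eE]]]; exists b; suff : M (val (b * y) - e) by [].
  have -> : val (b * y) - e = (-1) *: m.
    by rewrite {1}eE scaleN1r opprD addrCA subrr addr0.
  exact: MZ.
by apply: phiM; exact: xphi.
Qed.

Lemma corner_derivation_eq0 (D : A -> A) : semisimple (left_multiples e) ->
  linear D -> (forall x, e ** D x = D x) ->
  (forall x y, e ** x = x -> e ** y = y -> D (x ** y) = D x ** y + x ** D y) ->
  forall x, e ** x = x -> D x = 0.
Proof.
move=> ss Dlin De DM x ex.
have DeP y : D y \in corner_pred by rewrite corner_predE De.
have ex' : x \in corner_pred by rewrite corner_predE ex.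
pose D' (y : eA) : eA := exist (fun x => x \in corner_pred) _ (DeP (val y)).
have D'l c y z : D' (c *: y + z) = c *: D' y + D' z.
  by apply: val_inj; rewrite /= -Dlin.
have D'D y z : D' (y + z) = D' y + D' z by rewrite -[y]scale1r D'l !scale1r.
have D'00 : D' 0 = 0 by apply: (addIr (D' 0)); rewrite -D'D !add0r.
have D'0 : forall y, D' y = 0.
  apply: (derivation_eq0 corner_banach_norm) => [//|c y|y z|]; last exact: corner_semisimple.
  - by rewrite -[c *: y]addr0 D'l D'00 addr0.
  - by apply: val_inj; rewrite raddfD /= DM ?corner_fix.
by have := congr1 val (D'0 (exist (fun x => x \in corner_pred) x ex')).
Qed.

End Corner.

(** * Jordan derivations of A *)

Section JordanDerivations.
Variables (R : realType) (A : banachAlgType R) (e : A).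
Hypotheses (he : right_identity e) (hc : commutative_on (left_multiples e)).
Hypothesis (ss : semisimple (left_multiples e)).

Lemma bmul_right_annihilated a n : e ** n = 0 -> a ** n = 0.
Proof. by move=> en; rewrite -(he a) -bmulA en bmul0. Qed.

Lemma bmul_left_multiple a x : a ** (e ** x) = a ** x.
Proof. by rewrite bmulA he. Qed.

Section Jordan.
Variables (d : A -> A) (dJ : jordan_derivation d).

Lemma jordanD x y : d (x + y) = d x + d y.
Proof. by case: dJ => dl _; rewrite -[x]scale1r dl !scale1r. Qed.

Lemma jordan0 : d 0 = 0.
Proof. by apply: (addIr (d 0)); rewrite -jordanD !add0r. Qed.

Lemma jordan_polarized x y :
  d (x ** y) + d (y ** x) = d x ** y + x ** d y + (d y ** x + y ** d x).
Proof.
case: dJ => _ dsq; have := dsq (x + y).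
rewrite !(bmulDl, bmulDr) !jordanD !(bmulDl, bmulDr) !dsq => H.
apply: (addrI (d x ** x + x ** d x + (d y ** y + y ** d y))).
rewrite [LHS](AC (2*2*2) ((1*2*5)*(6*(3*4)))) [LHS]H.
by rewrite [LHS](AC ((2*2)*(2*2)) ((1*5*(4*8))*(3*6*(2*7)))).
Qed.

Lemma jordan_right_identity : e ** d e = 0.
Proof.
case: dJ => _ /(_ e); rewrite !he => H.
by apply: (addrI (d e)); rewrite addr0 -H.
Qed.

(** Polarizing at [n] and [e] leaves [d n = d n + e ** d n], since
    [n ** d e = n ** (e ** d e) = 0]. *)
Lemma jordan_annihilated n : e ** n = 0 -> e ** d n = 0.
Proof.
move=> en; have := jordan_polarized n e.
rewrite he en jordan0 addr0 he (bmul_right_annihilated (d e) en) add0r.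
rewrite -(bmul_left_multiple n) jordan_right_identity bmul0 addr0 => H.
by apply: (addrI (d n)); rewrite addr0 -H.
Qed.

Lemma annihilated_complement x : e ** (x - e ** x) = 0.
Proof. by rewrite bmulBr bmul_left_multiple subrr. Qed.

(** By commutativity every term of the polarized identity on eA occurs twice; division by 2 makes
    [D] a derivation, to which Johnson's theorem applies. The case [e = 0] is split off because
    [corner] is a nonzero ring. *)
Lemma jordan_left_multiple x : e ** d (e ** x) = 0.
Proof.
have [e0|e0] := eqVneq e 0; first by rewrite {1}e0 b0mul.
have dl := dJ.1; have ex : e ** (e ** x) = e ** x by rewrite bmul_left_multiple.
pose D y := e ** d (e ** y).
suff : D (e ** x) = 0 by rewrite /D ex.
apply: (corner_derivation_eq0 he hc e0 ss (D := D)) ex => [c y z|y|{}x y ex ey].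
- by rewrite /D bmulDr bmulZr dl bmulDr bmulZr.
- by rewrite /D bmul_left_multiple.
have exy : e ** (x ** y) = x ** y by rewrite bmulA ex.
have comm u v : e ** u = u -> e ** v = v -> u ** v = v ** u.
  by move=> eu ev; apply: hc; apply/(left_multiplesP he).
have eX z : e ** (e ** d z) = e ** d z by rewrite bmul_left_multiple.
rewrite /D ex ey exy.
move: (congr1 (bmul e) (jordan_polarized x y)).
rewrite (comm y x) // !bmulDr !(bmulA e) ex ey.
rewrite -(bmul_left_multiple x (d y)) -(bmul_left_multiple y (d x)).
rewrite (comm _ _ (eX y) ex) (comm _ _ ey (eX x)) [X in _ = _ + X]addrC -!mulr2n.
move/eqP; rewrite -subr_eq0 -mulrnBl -scaler_nat scaler_eq0 pnatr_eq0 subr_eq0.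
by move/eqP.
Qed.

Lemma jordan_range x : e ** d x = 0.
Proof.
rewrite -[x](subrK (e ** x)) jordanD bmulDr jordan_left_multiple addr0.
exact/jordan_annihilated/annihilated_complement.
Qed.

Lemma bmul_jordan a x : a ** d x = 0.
Proof. exact/bmul_right_annihilated/jordan_range. Qed.

(** Polarizing at [e ** x] and [e] gives [d (e ** x) = d e ** x]. *)
Lemma jordan_eq x : d x = d e ** x + d (x - e ** x).
Proof.
have := jordan_polarized (e ** x) e.
rewrite !he bmul_left_multiple !bmul_jordan !addr0 bmul_left_multiple.
by move=> /addrI <-; rewrite -jordanD subrKC.
Qed.

(** For [n] with [e ** n = 0], polarizing at [n] and [e ** z] gives [d (n ** z) = d n ** z];
    [jordan_eq] reduces the general case to this one. *)
Lemma jordanM x y : d (x ** y) = d x ** y.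
Proof.
have key n z : e ** n = 0 -> d (n ** z) = d n ** z.
  move=> en; have := jordan_polarized n (e ** z).
  rewrite !bmul_jordan !addr0 !(bmul_right_annihilated _ en) jordan0 !addr0.
  by rewrite !bmul_left_multiple.
rewrite jordan_eq (jordan_eq x) bmulDl -bmulA; congr (_ + _).
by rewrite -key ?annihilated_complement // bmulBl bmulA.
Qed.

End Jordan.

(** Adding the line through [n] to [M] gives a left ideal, as [b ** (m + c *: n) = b ** m]. Were it
    everything, the modular unit would be [u = m + c *: n], so [b ** u] and hence every [b] would
    lie in [M]. *)
Lemma annihilated_radical n : e ** n = 0 -> radical [set: A] n.
Proof.
move=> en; split=> // M [[_ M0 MD MZ MM] MneT [u _ Mu] Mmax].
have an a := bmul_right_annihilated a en.
pose J : set A := [set a | exists m c, M m /\ a = m + c *: n].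
have MJ : M `<=` J by move=> m Mm; exists m, 0; rewrite scale0r addr0.
have JE : J <> [set: A] -> J = M.
  move=> JneT; apply: Mmax => //; split=> //; first exact: MJ.
  - move=> _ _ [m [c [Mm ->]]] [m' [c' [Mm' ->]]]; exists (m + m'), (c + c').
    by split; [exact: MD|rewrite scalerDl addrACA].
  - move=> b _ [m [c [Mm ->]]]; exists (b *: m), (b * c).
    by split; [exact: MZ|rewrite scalerDr scalerA].
  - move=> b _ _ [m [c [Mm ->]]]; apply: MJ.
    by rewrite bmulDr bmulZr an scaler0 addr0; exact: MM.
have [JT|/JE <-] := pselect (J = [set: A]); last first.
  by exists 0, 1; rewrite scale1r add0r.
exfalso; apply: MneT; apply/seteqP; split=> // b _.
have [m [c [Mm uE]]] : J u by rewrite JT.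
have := Mu b I; rewrite uE bmulDr bmulZr an scaler0 addr0 => Mb.
by rewrite -(subrK (b ** m) b); apply: MD => //; exact: MM.
Qed.

Lemma bexp_idempotent (a : A) k : a ** a = a -> bexp a k = a.
Proof. by move=> aa; rewrite /bexp; elim: k.-1 => //= n ->. Qed.

(** Commuting the central value with [e] gives [d a ** bexp a k = 0]. The exponent disappears on the
    idempotents [e] and [e + n] with [e ** n = 0], which yield [d e = 0] and [d n = 0]. *)
Lemma centralizing_jordan_eq0 k (d : A -> A) : jordan_derivation d -> centralizing k d ->
  d = cst 0.
Proof.
move=> dJ [_ dC].
have dk a : d a ** bexp a k = 0.
  have := dC a e; rewrite bmul_jordan // subr0 he bmulA jordan_range //.
  by rewrite b0mul.
have de : d e = 0.
  by have := dk e; rewrite bexp_idempotent he.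
apply/funext => x; rewrite jordan_eq // de b0mul add0r /=.
move: (annihilated_complement x); move: (x - e ** x) => n en.
have an a := bmul_right_annihilated a en.
have := dk (e + n); rewrite bexp_idempotent; last first.
  by rewrite !(bmulDl, bmulDr) !he !an !addr0.
by rewrite (jordanD dJ) de add0r bmulDr he an addr0.
Qed.

End JordanDerivations.

Theorem corollary2p3 (R : realType) (A : banachAlgType R) (e : A)
    (he : right_identity e)
    (hcomm : commutative_on (left_multiples e))
    (hss : semisimple (left_multiples e)) :
  [/\ forall d : A -> A, jordan_derivation d ->
        range d `<=` radical [set: A],
      forall d1 d2 : A -> A, jordan_derivation d1 -> jordan_derivation d2 ->
        derivation (d1 \o d2) &
      forall k : nat, (0 < k)%N -> forall d : A -> A,
        (jordan_derivation d /\ centralizing k d) <-> d = cst 0].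
Proof.
split.
- move=> d dJ _ [x _ <-]; apply: (annihilated_radical he).
  exact: (jordan_range he hcomm hss dJ).
- move=> d1 d2 d1J d2J; split.
    by move=> c x y; rewrite /= d2J.1 d1J.1.
  move=> x y /=; rewrite (jordanM he hcomm hss d2J) (jordanM he hcomm hss d1J).
  by rewrite (bmul_jordan he hcomm hss d1J) addr0.
- move=> k _ d; split=> [[dJ dC]|->].
    exact: (centralizing_jordan_eq0 he hcomm hss dJ dC).
  have l0 : linear (cst 0 : A -> A) by move=> c x y; rewrite /= scaler0 addr0.
  split; split=> //= a; first by rewrite b0mul bmul0 addr0.
  by rewrite b0mul bmul0 subrr => b; rewrite b0mul bmul0.
Qed.
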